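(* Let $B$ be a Polish metric space and let $\widehat{\mathcal{F}}_B$ denote the set of isometry (isomorphism) classes of fully supported $mm$-fields over $B$. Then $d_{GP}$ is a metric on $\widehat{\mathcal{F}}_B$, and $(\widehat{\mathcal{F}}_B,d_{GP})$ is a Polish (complete and separable) metric space.
   Context: A Polish metric space is a complete separable metric space. Fix a Polish metric space $(B,d_B)$. A $B$-field is a triple $(X,d_X,\pi_X)$ with $(X,d_X)$ a Polish metric space and $\pi_X\colon X\to B$ 1-Lipschitz. An $mm$-field over $B$ is a quadruple $\mathcal{X}=(X,d_X,\pi_X,\mu_X)$, where $(X,d_X,\pi_X)$ is a $B$-field and $\mu_X$ is a Borel probability measure on $X$; it is fully supported if $\mathrm{supp}\,\mu_X=X$. Two $mm$-fields are isomorphic if there is a bijective isometry $\phi\colon X\to Y$ with $\pi_Y\circ\phi=\pi_X$ and $\phi_*(\mu_X)=\mu_Y$; isometry classes of $mm$-fields are the classes for this relation. An isometric embedding $\Phi\colon\mathcal{X}\Rightarrow\mathcal{Z}$ of $B$-fields over $B$ is a distance-preserving map $\phi\colon X\to Z$ with $\pi_Z\circ\phi=\pi_X$. The Gromov-Prokhorov distance is $d_{GP}(\mathcal{X},\mathcal{Y}):=\inf_{\mathcal{Z},\Phi,\Psi}d_P^Z(\phi_*(\mu_X),\psi_*(\mu_Y))$, where the infimum is over all $B$-fields $\mathcal{Z}=(Z,d_Z,\pi_Z)$ and isometric embeddings $\Phi,\Psi$ of (the underlying $B$-fields of) $\mathcal{X},\mathcal{Y}$ into $\mathcal{Z}$ over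 $B$, and $d_P^Z$ is the Prokhorov distance between Borel probability measures on $Z$. *)

(* Defs.v *)
From HB Require Import structures.
From mathcomp Require Import all_boot all_order all_algebra.
From mathcomp Require Import all_classical all_reals all_analysis.
Set Implicit Arguments.
Unset Strict Implicit.
Unset Printing Implicit Defensive.
Import Order.TTheory GRing.Theory Num.Theory.

Local Open Scope classical_set_scope.
Local Open Scope ring_scope.

(* The type of isomorphism classes of mm-fields lives in a universe strictly
   above the one of the carriers of mm-fields. Making it a metricType, or using
   countable on it, would force these carriers to live strictly below the
   universe of the carriers of the library's structures (no mm-field could then
   be built on a generic choiceType or on a quotient type). The properties below
   are therefore stated for a distance function on an arbitrary type; they are
   used both for metricTypes, with d := mdist, and for the space of classes. *)
Section distance_functions.
Context {R : realType} {T : Type}.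
Variable d : T -> T -> R.

Definition is_metric : Prop :=
  [/\ forall x y, 0 <= d x y,
      forall x y, d x y = 0 <-> x = y,
      forall x y, d x y = d y x
    & forall x y z, d x z <= d x y + d y z].

Definition cauchy_sequence (u : nat -> T) : Prop :=
  forall e : R, 0 < e ->
    exists N, forall m n, (N <= m)%N -> (N <= n)%N -> d (u m) (u n) < e.

Definition converges_to (u : nat -> T) (l : T) : Prop :=
  forall e : R, 0 < e -> exists N, forall n, (N <= n)%N -> d (u n) l < e.

Definition complete_distance : Prop :=
  forall u, cauchy_sequence u -> exists l, converges_to u l.

Definition countable_pred (D : T -> Prop) : Prop :=
  exists f : T -> nat, forall x y, D x -> D y -> f x = f y -> x = y.

Definition separable_distance : Prop :=
  exists2 D : T -> Prop, countable_pred D &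
    forall (x : T) (e : R), 0 < e -> exists2 y, D y & d x y < e.

Definition is_polish_metric : Prop :=
  [/\ is_metric, complete_distance & separable_distance].

End distance_functions.

(* Measurable types are pointed in the library. Requiring a point is harmless:
   a space carrying a probability measure is nonempty, and so is any space
   into which it embeds. No definition below uses the chosen point. *)
#[short(type="pmetricType")]
HB.structure Definition PointedMetric (K : numDomainType) :=
  {M of Metric K M & isPointed M}.

Section borel.
Context {R : realType}.

Definition borel (X : pmetricType R) : measurableType (@open X).-sigma :=
  g_sigma_algebraType (@open X).

Definition measure_support (X : pmetricType R)
    (mu : set (borel X) -> \bar R) : set X :=
  [set x | forall U : set X, open U -> U x -> (0 < mu U)%E].

Definition thickening (Z : pmetricType R) (A : set Z) (e : R) : set Z :=
  [set z | exists2 a, A a & mdist a z < e].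

(* The set is nonempty when mu and nu are probabilities: it contains every
   e >= 1. *)
Definition prokhorov (Z : pmetricType R)
    (mu nu : set (borel Z) -> \bar R) : R :=
  inf [set e : R | 0 < e /\
    forall A : set (borel Z), measurable A ->
      (mu A <= nu (thickening A e) + e%:E)%E /\
      (nu A <= mu (thickening A e) + e%:E)%E].

End borel.

Section fields.
Context {R : realType}.
Variable B : metricType R.

Record bField := BField {
  bf_space :> pmetricType R;
  bf_polish : is_polish_metric (@mdist R bf_space);
  bf_proj : bf_space -> B;
  bf_proj_lip : forall x y, mdist (bf_proj x) (bf_proj y) <= mdist x y
}.

Record mmField := MMField {
  mm_field :> bField;
  mm_measure : probability (borel mm_field) R
}.

Definition fully_supported (X : mmField) : Prop :=
  measure_support (@mm_measure X) = setT.

Definition isometric_embedding (X Z : bField) (phi : X -> Z) : Prop :=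
  (forall x y, mdist (phi x) (phi y) = mdist x y) /\
  (forall x, bf_proj (phi x) = bf_proj x).

Definition mm_pushforward (X : mmField) (Z : bField) (phi : X -> Z) :
    set (borel Z) -> \bar R :=
  pushforward (T1 := borel X) (T2 := borel Z) (@mm_measure X) phi.

Definition mm_isomorphic (X Y : mmField) : Prop :=
  exists phi : X -> Y,
    [/\ bijective phi, isometric_embedding phi
      & forall A : set (borel Y), measurable A ->
          mm_pushforward phi A = mm_measure Y A].

(* The infimum is over a nonempty set: for x0 in X and y0 in Y, the disjoint
   union of X and Y with d x y := d x x0 + c + d y0 y, where c is positive and
   at least the distance of the projections of x0 and y0, is a B-field. *)
Definition dGP (X Y : mmField) : R :=
  inf [set r : R | exists (Z : bField) (phi : X -> Z) (psi : Y -> Z),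
    [/\ isometric_embedding phi, isometric_embedding psi
      & r = prokhorov (mm_pushforward phi) (mm_pushforward psi)]].

Definition fsField := {X : mmField | fully_supported X}.

Definition fs_isomorphic (X Y : fsField) : Prop :=
  mm_isomorphic (sval X) (sval Y).

Definition isoClasses :=
  {C : fsField -> Prop | exists X, C = fs_isomorphic X}.

Definition isoClass (X : fsField) : isoClasses :=
  exist _ (fs_isomorphic X) (ex_intro _ X erefl).

Definition isoRepr (C : isoClasses) : fsField := sval (cid (svalP C)).

Definition dGP_classes (C D : isoClasses) : R :=
  dGP (sval (isoRepr C)) (sval (isoRepr D)).

End fields.

(* Main.v *)
Require Import Defs.
From HB Require Import structures.
From mathcomp Require Import all_boot all_order all_algebra.
From mathcomp Require Import all_classical all_reals all_analysis.
From mathcomp Require Import lra ring.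
Set Implicit Arguments.
Unset Strict Implicit.
Unset Printing Implicit Defensive.
Import Order.TTheory GRing.Theory Num.Theory.
Import numFieldNormedType.Exports.
Local Open Scope classical_set_scope.
Local Open Scope ring_scope.

(* A common embedding of X and Y amounts to a function delta : X -> Y -> R which,
   with the metrics of X and Y, is a pseudometric on the disjoint union: adding
   a small constant to delta gives a complete separable metric there. So
   d_GP(X, Y) < e means, up to a small loss, that such a delta exists with
   mu(A) <= nu({y | delta(x, y) < e for some x in A}) + e for all Borel A.

   Definiteness: if d_GP(X, Y) = 0, an ultrafilter limit of functions delta_n with
   e_n -> 0 transports mu to nu for every e > 0. By full support every point of
   X is then at delta-distance 0 from a unique point of Y, and conversely.

   Separability: up to e, a field is determined by finitely many points carrying
   most of the mass, through rounded distances, rounded masses of disjoint cells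
   around them, and nearby points of a dense sequence of B.

   Completeness: for a sequence X_n with d_GP(X_n, X_n+1) < 2^-n, the finite form
   of Strassen's theorem (a weighted Hall theorem) gives finite-valued random
   variables f_n : [0, 1] -> X_n, almost distributed as mu_n, such that f_n and
   f_n+1 are at delta_n-distance < 3 2^-n outside a set of measure 3 2^-n. Almost
   everywhere d(f_n(s), f_n(t)) converges to a pseudometric rho(s, t). The limit
   is the completion of the support of rho, with the law of the inclusion. *)

(** * Real-valued probabilities *)

(** The pseudometrics delta_n of a sequence X_n, Y are defined on uncountably many pairs and neither
    space is compact, so no subsequence obviously converges. An ultrafilter takes all limits at
    once, and full support is what keeps each sequence delta_n(x, y) bounded.

    For completeness, the X_n lie in no common space. Random variables on one probability space
    replace it, and their pairwise distances only have to converge in R. Finite values reduce the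
    coupling to a finite flow problem, and since [0, 1] has no atoms, f_n+1 can be built inside the
    fibres of the given f_n, so that all the couplings hold on one space.

    In 3 2^-n, one term comes from the law of f_n, one from the transport by delta_n, and one from
    the discretization of X_n+1. The tails sum to 6 2^-n, hence an error of 12 2^-n on rho, which
    involves two points. *)

Section real_probability.
Context d (T : measurableType d) (R : realType) (P : probability T R).

Definition Pr (A : set T) : R := fine (P A).

Lemma PrE A : measurable A -> P A = (Pr A)%:E.
Proof. by move=> mA; rewrite /Pr fineK// fin_num_measure. Qed.

Lemma Pr_ge0 A : 0 <= Pr A.
Proof. by rewrite /Pr fine_ge0. Qed.

Lemma Pr_le1 A : measurable A -> Pr A <= 1.
Proof. by move=> mA; rewrite -lee_fin -PrE// probability_le1. Qed.

Lemma PrT : Pr setT = 1.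
Proof. by rewrite /Pr probability_setT. Qed.

Lemma Pr0 : Pr set0 = 0.
Proof. by rewrite /Pr measure0. Qed.

Lemma le_Pr A B : measurable A -> measurable B -> A `<=` B -> Pr A <= Pr B.
Proof.
by move=> mA mB AB; rewrite -lee_fin -!PrE// le_measure// inE.
Qed.

Lemma PrC A : measurable A -> Pr (~` A) = 1 - Pr A.
Proof.
move=> mA; apply: EFin_inj; rewrite EFinB -!PrE//; last exact: measurableC.
by rewrite probability_setC.
Qed.

Lemma PrU A B : measurable A -> measurable B -> A `&` B = set0 ->
  Pr (A `|` B) = Pr A + Pr B.
Proof.
move=> mA mB AB; apply: EFin_inj; rewrite EFinD -!PrE//.
  by rewrite measureU.
exact: measurableU.
Qed.

Lemma PrDI A B : measurable A -> measurable B ->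
  Pr A = Pr (A `\` B) + Pr (A `&` B).
Proof.
move=> mA mB; rewrite -PrU.
- congr Pr; apply/seteqP; split=> [x Ax|x [[]|[]]//].
  by have [Bx|Bx] := pselect (B x); [right|left].
- exact: measurableD.
- exact: measurableI.
- by rewrite -subset0 => x [[_ nB] [_ B']].
Qed.

Lemma PrU_le A B : measurable A -> measurable B -> Pr (A `|` B) <= Pr A + Pr B.
Proof.
move=> mA mB; rewrite -lee_fin EFinD -!PrE//; last exact: measurableU.
exact: measureU2.
Qed.

Lemma Pr_bigcup_null (F : nat -> set T) :
  (forall n, measurable (F n)) -> (forall n, Pr (F n) = 0) ->
  Pr (\bigcup_n F n) = 0.
Proof.
move=> mF F0; apply/eqP;
  rewrite eq_le Pr_ge0 andbT -lee_fin -(@PrE (\bigcup_n F n));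
  last exact: bigcupT_measurable.
apply: (le_trans (measure_sigma_subadditive P mF _ _)) => //.
  exact: bigcupT_measurable.
have PF0 n : P (F n) = 0%E by rewrite PrE// F0.
by rewrite eseries0 // => n _ _; exact: PF0.
Qed.

Lemma Pr_bigcup_gt (F : nat -> set T) (a : R) :
  (forall n, measurable (F n)) -> {homo F : n m / (n <= m)%N >-> n `<=` m} ->
  a < Pr (\bigcup_n F n) -> exists n, a < Pr (F n).
Proof.
move=> mF ndF aF.
have mU : measurable (\bigcup_n F n) by exact: bigcupT_measurable.
have cv : Pr (F n) @[n --> \oo] --> Pr (\bigcup_n F n).
  apply: fine_cvg; rewrite fineK ?fin_num_measure//;
    apply: nondecreasing_cvg_mu => //.
  by move=> n m nm; apply/subsetPset/ndF.
have [N _ /(_ N (leqnn N)) /= aN] := cvgr_gt _ cv _ aF.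
by exists N.
Qed.

Lemma Pr_bigcap_lt (F : nat -> set T) (a : R) :
  (forall n, measurable (F n)) -> {homo F : n m / (n <= m)%N >-> m `<=` n} ->
  Pr (\bigcap_n F n) < a -> exists n, Pr (F n) < a.
Proof.
move=> mF niF; have mFC n : measurable (~` F n) by exact: measurableC.
have mI : measurable (\bigcap_n F n) by exact: bigcapT_measurable.
rewrite -[X in Pr X]setCK PrC ?setC_bigcap; last exact: bigcupT_measurable.
rewrite ltrBlDr -ltrBlDl => h.
have [n] := Pr_bigcup_gt mFC (fun n m nm => subsetC (niF _ _ nm)) h.
by rewrite PrC// ltrBrDl -ltrBrDr opprB addrCA subrr addr0; exists n.
Qed.

(** Bounding every partial sum by [b] stands for a convergent series, so no extended reals occur. *)
Lemma Pr_bigcup_le_sum (F : nat -> set T) (a : nat -> R) (b : R) :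
  (forall n, measurable (F n)) -> (forall n, Pr (F n) <= a n) ->
  (forall n, \sum_(i < n) a i <= b) -> Pr (\bigcup_n F n) <= b.
Proof.
move=> mF Fa ab; rewrite leNgt; apply/negP => h.
pose U n := \big[setU/set0]_(i < n) F i.
have mU n : measurable (U n) by exact: bigsetU_measurable.
have [|||n] := @Pr_bigcup_gt U b.
- by [].
- by move=> n m nm; exact: subset_bigsetU.
- apply: lt_le_trans h _; apply: le_Pr; [exact: bigcupT_measurable..|].
  move=> x [k _ Fk]; exists k.+1 => //.
  by rewrite /U big_ord_recr/=; right.
apply/negP; rewrite -leNgt; apply: le_trans (ab n).
rewrite /U; elim: n => [|n ih]; first by rewrite !big_ord0 Pr0.
rewrite !big_ord_recr/=; apply: le_trans (PrU_le _ _) (lerD ih (Fa n)) => //.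
exact: mU.
Qed.

(** Used for cells of a field and for fibres of labels, with [Q] selecting those that meet a given
    set. Measurability and mass come from the same induction. *)
Lemma Pr_disjoint_sum (N : nat) (Q : pred nat) (F : nat -> set T) :
  (forall i, measurable (F i)) -> (forall i j s, F i s -> F j s -> i = j) ->
  measurable [set s | exists i, [/\ (i < N)%N, Q i & F i s]] /\
  Pr [set s | exists i, [/\ (i < N)%N, Q i & F i s]] =
  \sum_(i < N | Q i) Pr (F i).
Proof.
move=> mF dF; elim: N => [|N [ihm ih]].
  rewrite (_ : [set _ | _] = set0) ?big_ord0 ?Pr0//.
  by rewrite -subset0 => s [i []].
rewrite [\sum_(_ < _ | _) _]big_mkcond big_ord_recr/= -big_mkcond/= -ih.
have [QN|QN] := boolP (Q N).
  rewrite (_ : [set s | exists i, [/\ (i < N.+1)%N, Q i & F i s]] =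
    [set s | exists i, [/\ (i < N)%N, Q i & F i s]] `|` F N).
    split; first exact: measurableU.
    rewrite PrU// -subset0 => s [[i [iN _ Fi]] FN].
    by move: iN; rewrite (dF _ _ _ Fi FN) ltnn.
  apply/seteqP; split=> s /=.
    move=> [i []]; rewrite ltnS leq_eqVlt => /orP[/eqP ->|iN] Qi Fi;
      first by right.
    by left; exists i.
  move=> [[i [iN Qi Fi]]|FN]; first by exists i; split=> //; exact: ltnW.
  by exists N.
rewrite addr0 (_ : [set s | exists i, [/\ (i < N.+1)%N, Q i & F i s]] =
    [set s | exists i, [/\ (i < N)%N, Q i & F i s]])//.
apply/seteqP; split=> s /= [i [iN Qi Fi]]; exists i; split => //;
  last exact: ltnW.
by rewrite ltn_neqAle -ltnS iN andbT; apply: contraNneq QN => <-.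
Qed.

End real_probability.

(** * Metrics on disjoint unions of fields *)

Section inf_family.
Context (R : realType) (I : Type) (f : I -> R).

Lemma inf_family_le i : (forall j, 0 <= f j) -> inf (range f) <= f i.
Proof.
move=> f0; apply: ge_inf; last by exists i.
by exists 0 => _ [j _ <-].
Qed.

Lemma le_inf_family (a : R) (i0 : I) : (forall i, a <= f i) -> a <= inf (range
  f).
Proof.
move=> af; apply: lb_le_inf; first by exists (f i0), i0.
by move=> _ [j _ <-].
Qed.

End inf_family.

(** The sequence lists the dense set by code; [t0] fills the codes that no point has. *)
Lemma dense_sequence (R : realType) (T : choiceType) (d : T -> T -> R) (t0 : T)
  :
  separable_distance d ->
  exists u : nat -> T, forall x (e : R), 0 < e -> exists k, d x (u k) < e.
Proof.
move=> [D [f finj] Dd]; pose Q k := [set y | D y /\ f y = k].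
exists (fun k => xget t0 (Q k)) => x e /(Dd x)[y Dy xy]; exists (f y).
by have [Dz /finj -> //] := xgetPex t0 (ex_intro (Q (f y)) y (conj Dy erefl)).
Qed.

Section metric_borel.
Context (R : realType) (X : pmetricType R).
Implicit Types (x y : X) (A : set X).

Lemma open_metricP A :
  open A <-> forall x, A x -> exists2 e, 0 < e & forall y, mdist x y < e -> A y.
Proof.
rewrite openE; split=> [h x /h|h x /h [e e0 eA]].
  by move=> /nbhs_ballP[e e0 eA]; exists e => // y xy; apply: eA;
    rewrite ballEmdist.
by apply/nbhs_ballP; exists e => //; rewrite ballEmdist => y; exact: eA.
Qed.

Lemma open_metric_ball x e : open [set y | mdist x y < e].
Proof.
apply/open_metricP => y /= xy; exists (e - mdist x y);
  first by rewrite subr_gt0.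
by move=> z yz; have := metric_triangle x y z; lra.
Qed.

Lemma closed_metricP A :
  closed A <-> forall x, (forall e, 0 < e -> exists2 y, A y & mdist x y < e) ->
    A x.
Proof.
split=> [cA x h|h].
  apply: contrapT => nA.
  have /open_metricP/(_ x nA)[e e0 eA] : open (~` A) by exact: closed_openC.
  by have [y Ay /eA] := h _ e0.
rewrite -openC; apply/open_metricP => x /= nA.
apply: contrapT => H; apply: nA; apply: h => e e0; apply: contrapT => H2.
apply: H; exists e => // y xy Ay; apply: H2; by exists y.
Qed.

Lemma measurable_open A : open A -> measurable (A : set (borel X)).
Proof. by move=> oA; exact: sub_sigma_algebra. Qed.

Lemma measurable_closed A : closed A -> measurable (A : set (borel X)).
Proof.
move=> cA; rewrite -[A]setCK; apply: measurableC.
by apply: measurable_open; exact: closed_openC.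
Qed.

Lemma measurable_metric_ball x e : measurable ([set y | mdist x y < e] : set
  (borel X)).
Proof. by apply: measurable_open; exact: open_metric_ball. Qed.

Lemma separable_dense_sequence : is_polish_metric (@mdist R X) ->
  exists u : nat -> X, forall x e, 0 < e -> exists k, mdist x (u k) < e.
Proof. by move=> [_ _]; exact: dense_sequence point. Qed.

End metric_borel.

Section thick.
Context (R : realType) (X Y : Type).
Implicit Types (A : set X) (e : R).

(** The trace on [Y] of the thickening of [A] in the disjoint union. *)
Definition thick (delta : X -> Y -> R) A e : set Y :=
  [set y | exists2 x, A x & delta x y < e].

End thick.

Section cross_metrics.
Context {R : realType} {B : metricType R}.

(* [delta] together with the metrics of [X] and [Y] is a pseudometric on the
   disjoint union of [X] and [Y], for which the projections are 1-Lipschitz. *)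
Definition cross_metric (X Y : bField B) (delta : X -> Y -> R) : Prop :=
  [/\ forall x y, mdist (bf_proj x) (bf_proj y) <= delta x y,
      forall x x' y, delta x y <= mdist x x' + delta x' y,
      forall x y y', delta x y <= delta x y' + mdist y' y,
      forall x x' y, mdist x x' <= delta x y + delta x' y
    & forall x y y', mdist y y' <= delta x y + delta x y'].

Section theory.
Context (X Y : bField B) (delta : X -> Y -> R).
Hypothesis dP : cross_metric delta.

Lemma cross_metric_ge0 x y : 0 <= delta x y.
Proof. by case: dP => + _ _ _ _ => /(_ x y); apply: le_trans;
  exact: mdist_ge0. Qed.

Lemma cross_metric_sym : cross_metric (fun y x => delta x y).
Proof.
case: dP => d1 d2 d3 d4 d5; split=> //.
- by move=> y x; rewrite metric_sym.
- by move=> y y' x; rewrite metric_sym addrC.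
- by move=> y x x'; rewrite metric_sym addrC.
Qed.

Lemma open_thick A e : open (thick delta A e).
Proof.
case: dP => _ _ d3 _ _; apply/open_metricP => y [x Ax xy].
exists (e - delta x y); first by rewrite subr_gt0.
by move=> z yz; exists x => //; have := d3 x z y; lra.
Qed.

Lemma measurable_thick A e : measurable (thick delta A e : set (borel Y)).
Proof. by apply: measurable_open; exact: open_thick. Qed.

End theory.

Section composition.
Context (X Y W : bField B) (delta1 : X -> Y -> R) (delta2 : Y -> W -> R).
Hypotheses (d1P : cross_metric delta1) (d2P : cross_metric delta2).

(** The two disjoint unions are amalgamated along [Y], and [Y] is then forgotten. *)
Definition cross_comp x w := inf (range (fun y => delta1 x y + delta2 y w)).

Let f0 x w y : 0 <= delta1 x y + delta2 y w.
Proof. by rewrite addr_ge0// (cross_metric_ge0 d1P, cross_metric_ge0 d2P). Qed.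

Lemma cross_comp_le x y w : cross_comp x w <= delta1 x y + delta2 y w.
Proof. exact: (inf_family_le y (f0 x w)). Qed.

Lemma cross_metric_comp : cross_metric cross_comp.
Proof.
case: (d1P) (d2P) => a1 a2 a3 a4 a5 [b1 b2 b3 b4 b5].
have cle := cross_comp_le.
split.
- move=> x w; apply: (le_inf_family point) => y.
  by have := metric_triangle (bf_proj x) (bf_proj y) (bf_proj w);
    move: (a1 x y) (b1 y w); lra.
- move=> x x' w; rewrite -lerBlDl; apply: (le_inf_family point) => y.
  by move: (cle x y w) (a2 x x' y); lra.
- move=> x w w'; rewrite -lerBlDr; apply: (le_inf_family point) => y.
  by move: (cle x y w) (b3 y w w'); lra.
(* The two infima have independent midpoints: the path is x, y, y', x', and its middle leg is
   bounded by [delta2] through [w]. *)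
- move=> x x' w; rewrite -lerBlDl; apply: (le_inf_family point) => y'.
  rewrite lerBlDl -lerBlDr; apply: (le_inf_family point) => y.
  by move: (a4 x x' y) (a3 x' y y') (b4 y y' w) (metric_sym y y'); lra.
- move=> x w w'; rewrite -lerBlDl; apply: (le_inf_family point) => y'.
  rewrite lerBlDl -lerBlDr; apply: (le_inf_family point) => y.
  by move: (b5 y w w') (b2 y y' w') (a5 x y y'); lra.
Qed.

End composition.

Section pairs.
Context (X Y : bField B) (I : Type) (i0 : I) (a : I -> X) (b : I -> Y) (c : R).
Hypotheses (abX : forall i j, mdist (a i) (a j) <= mdist (b i) (b j) + c *+ 2)
  (abY : forall i j, mdist (b i) (b j) <= mdist (a i) (a j) + c *+ 2)
  (abB : forall i, mdist (bf_proj (a i)) (bf_proj (b i)) <= c).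

(** [a i] and [b i] are joined by an edge of length [c]. A distortion of at most 2 [c] ensures that
    a detour over two edges shortens no distance. *)
Definition cross_of_pairs x y :=
  inf (range (fun i => mdist x (a i) + c + mdist (b i) y)).

Lemma cross_of_pairs_le x y i : cross_of_pairs x y <= mdist x (a i) + c + mdist
  (b i) y.
Proof.
apply: (@inf_family_le _ _ (fun i => mdist x (a i) + c + mdist (b i) y)) => j.
by rewrite !addr_ge0 ?mdist_ge0//; apply: le_trans (abB j); exact: mdist_ge0.
Qed.

Lemma cross_metric_of_pairs : cross_metric cross_of_pairs.
Proof.
have cle := cross_of_pairs_le.
split.
- move=> x y; apply: (le_inf_family i0) => i.
  have := metric_triangle (bf_proj x) (bf_proj (a i)) (bf_proj y).
  have := metric_triangle (bf_proj (a i)) (bf_proj (b i)) (bf_proj y).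
  by move: (bf_proj_lip x (a i)) (bf_proj_lip (b i) y) (abB i); lra.
- move=> x x' y; rewrite -lerBlDl; apply: (le_inf_family i0) => i.
  by move: (cle x y i) (metric_triangle x x' (a i)); lra.
- move=> x y y'; rewrite -lerBlDr; apply: (le_inf_family i0) => i.
  by move: (cle x y i) (metric_triangle (b i) y' y); lra.
- move=> x x' y; rewrite -lerBlDl; apply: (le_inf_family i0) => j.
  rewrite lerBlDl -lerBlDr; apply: (le_inf_family i0) => i.
  have := metric_triangle x (a i) x'; have := metric_triangle (a i) (a j) x'.
  have := metric_triangle (b i) y (b j).
  by move: (abX i j) (metric_sym y (b j)) (metric_sym (a j) x'); lra.
- move=> x y y'; rewrite -lerBlDl; apply: (le_inf_family i0) => j.
  rewrite lerBlDl -lerBlDr; apply: (le_inf_family i0) => i.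
  have := metric_triangle y (b i) y'; have := metric_triangle (b i) (b j) y'.
  have := metric_triangle (a i) x (a j).
  by move: (abY i j) (metric_sym (a i) x) (metric_sym y (b i)); lra.
Qed.

End pairs.

End cross_metrics.

Section gp_close.
Context {R : realType} {B : metricType R}.
Implicit Types X Y W : mmField B.

Definition mass X (A : set X) : R := Pr (@mm_measure R B X) A.

(* One-sided Prokhorov inequalities suffice: see [transports_sym]. *)
Definition transports X Y (delta : X -> Y -> R) (e : R) : Prop :=
  forall A : set (borel X), measurable A -> mass A <= mass (thick delta A e) +
    e.

Definition gp_close X Y (e : R) : Prop :=
  exists2 delta : X -> Y -> R, cross_metric delta & transports delta e.

(* Apply the inequality to the complement of the thickening. *)
Lemma transports_sym X Y (delta : X -> Y -> R) e :
  cross_metric delta -> transports delta e ->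
  transports (fun y x => delta x y) e.
Proof.
move=> dP dt A mA; set A' := thick _ A e.
have mA' : measurable (A' : set (borel X)).
  exact: (measurable_thick (cross_metric_sym dP)).
have := dt _ (measurableC mA').
rewrite /mass PrC//.
suff : mass (thick delta (~` A') e) <= 1 - mass A by rewrite /mass; lra.
rewrite /mass -PrC//; apply: le_Pr.
- exact: measurable_thick.
- exact: measurableC.
- by move=> y [x xA' xy] Ay; apply: xA'; exists y.
Qed.

Lemma gp_close_sym X Y e : gp_close X Y e -> gp_close Y X e.
Proof.
move=> [delta dP dt]; exists (fun y x => delta x y);
  first exact: cross_metric_sym.
exact: transports_sym.
Qed.

Lemma gp_close_trans X Y W e e' : gp_close X Y e -> gp_close Y W e' -> gp_close
  X W (e + e').
Proof.
move=> [d1 d1P d1t] [d2 d2P d2t]; exists (cross_comp d1 d2).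
  exact: cross_metric_comp.
move=> A mA; apply: le_trans (d1t A mA) _.
have := d2t _ (measurable_thick d1P A e).
suff : mass (thick d2 (thick d1 A e) e') <=
  mass (thick (cross_comp d1 d2) A (e + e')) by rewrite /mass; lra.
apply: le_Pr.
- exact: measurable_thick.
- exact: (measurable_thick (cross_metric_comp d1P d2P)).
- move=> w [y [x Ax xy] yw]; exists x => //.
  apply: le_lt_trans (cross_comp_le d1P d2P x y w) _; exact: ltrD.
Qed.

(** With error 1 the mass inequality is trivial, so one edge between two points suffices. This also
    shows that the infimum in [dGP] is over a nonempty set. *)
Lemma gp_close1 X Y : gp_close X Y 1.
Proof.
pose c := mdist (bf_proj (point : X)) (bf_proj (point : Y)).
exists (cross_of_pairs (fun _ : unit => point : X) (fun _ : unit => point : Y)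
  c).
  apply: (cross_metric_of_pairs tt) => // [_ _|_ _];
  by rewrite !mdistxx add0r mulrn_wge0// mdist_ge0.
move=> A mA; apply: le_trans (Pr_le1 _ mA) _.
by rewrite lerDr Pr_ge0.
Qed.

End gp_close.

(** * Comparison with the Gromov-Prokhorov distance *)

Definition invS (R : realType) (n : nat) : R := n.+1%:R^-1.

Lemma invS_lt (R : realType) (e : R) : 0 < e ->
  exists N, forall n, (N <= n)%N -> invS R n < e.
Proof.
rewrite /invS => e0; exists (Num.truncn e^-1) => n Nn.
rewrite invf_plt ?posrE// (lt_le_trans (truncnS_gt _))// ler_nat.
by rewrite ltnS.
Qed.

Lemma invS_gt0 (R : realType) n : 0 < invS R n.
Proof. by rewrite invr_gt0. Qed.

Lemma le_invS (R : realType) n m : (n <= m)%N -> invS R m <= invS R n.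
Proof. by move=> nm; rewrite lef_pV2 ?posrE// ler_nat. Qed.

(** A copy of [T] that carries its metric and base point in its type, so that canonical structures
    can be attached to it. *)
Definition metric_on (R : realType) (T : Type) (d : T -> T -> R)
  (dP : is_metric d) (t0 : T) : Type := T.

Section metric_on.
Context (R : realType) (T : Type) (d : T -> T -> R) (dP : is_metric d) (t0 : T).

HB.instance Definition _ := gen_eqMixin (metric_on dP t0).
HB.instance Definition _ := gen_choiceMixin (metric_on dP t0).
HB.instance Definition _ := isPointed.Build (metric_on dP t0) t0.

Let dxx (x : T) : d x x = 0. Proof. by case: dP => _ h _ _; apply/h. Qed.
Let dpos (x y : T) : d x y = 0 -> x = y. Proof. by case: dP => _ h _ _ /h. Qed.
Let dsym (x y : T) : d x y = d y x. Proof. by case: dP => _ _ h _;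
  exact: h. Qed.
Let dtri (y x z : T) : d x z <= d x y + d y z.
Proof. by case: dP => _ _ _; exact. Qed.

HB.instance Definition _ := isMetric.Build R (metric_on dP t0) dxx dpos dsym
  dtri.

End metric_on.

Section lipschitz.
Context (R : realType) (X Y : pmetricType R) (f : X -> Y).

Lemma lipschitz_preimage_open (O : set Y) :
  (forall x x', mdist (f x) (f x') <= mdist x x') -> open O -> open (f @^-1` O).
Proof.
move=> fL /open_metricP oO; apply/open_metricP => x /oO[e e0 eO].
by exists e => // x' xx'; apply: eO; exact: le_lt_trans xx'.
Qed.

Lemma measurable_lipschitz :
  (forall x x', mdist (f x) (f x') <= mdist x x') ->
  measurable_fun setT (f : borel X -> borel Y).
Proof.
move=> fL; apply: (@measurability _ _ (borel X) (borel Y) setT f (@open Y)) =>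
  //.
move=> _ [U oU <-]; rewrite setTI.
by apply: measurable_open; exact: lipschitz_preimage_open.
Qed.

(** If images of points of [C] converge, these points form a Cauchy sequence because [f] is
    isometric, hence converge in [X]. *)
Lemma isometry_closed_image (C : set X) : complete_distance (@mdist R X) ->
  (forall x x', mdist (f x) (f x') = mdist x x') ->
  closed C -> closed (f @` C).
Proof.
move=> Xc fI /closed_metricP cC; apply/closed_metricP => z h.
have /choice[u uP] n : exists x, C x /\ mdist z (f x) < invS R n.
  by have [_ [x Cx <-] zx] := h _ (invS_gt0 R n); exists x.
have uz e : 0 < e -> exists N, forall n, (N <= n)%N -> mdist z (f (u n)) < e.
  move=> /invS_lt[N Ne]; exists N => n /Ne; apply: lt_trans.
  by have [] := uP n.
have [l ul] : exists l, converges_to (@mdist R X) u l.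
  apply: Xc => e e0; have [|N Ne] := uz (e / 2); first by rewrite divr_gt0.
  exists N => m n /Ne zm /Ne zn; rewrite -fI.
  by have := metric_triangle (f (u m)) z (f (u n));
    move: (metric_sym (f (u m)) z); lra.
have Cl : C l.
  apply: cC => e /ul[N Ne]; exists (u N); first by have [] := uP N.
  by rewrite metric_sym; exact: Ne.
exists l => //; apply/esym/mdist_positivity/eqP; rewrite eq_le mdist_ge0 andbT.
apply/ler_addgt0Pr => e e0; rewrite add0r.
have [|N Ne] := uz (e / 2); first by rewrite divr_gt0.
have [|M Me] := ul (e / 2); first by rewrite divr_gt0.
have := Ne _ (leq_maxl N M); have := Me _ (leq_maxr N M); rewrite -fI.
by have := metric_triangle z (f (u (maxn N M))) (f l); lra.
Qed.

End lipschitz.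

Section disjoint_union.
Context {R : realType} {B : metricType R} (X Y : bField B) (delta : X -> Y ->
  R).
Context (eta : R).
Hypotheses (dP : cross_metric delta) (eta0 : 0 < eta)
  (d_eta : forall x y, eta <= delta x y).

Definition sum_dist (s t : X + Y) : R :=
  match s, t with
  | inl x, inl x' => mdist x x'
  | inr y, inr y' => mdist y y'
  | inl x, inr y | inr y, inl x => delta x y
  end.

Lemma is_metric_sum : is_metric sum_dist.
Proof.
have dgt x y : 0 < delta x y by exact: lt_le_trans (d_eta x y).
case: dP => _ d2 d3 d4 d5.
split.
- by move=> [x|y] [x'|y']; rewrite /= ?mdist_ge0// ltW.
- move=> [x|y] [x'|y'] /=; split=> //.
  + by move=> /mdist_positivity ->.
  + by move=> [->]; rewrite mdistxx.
  + by move=> h; have := dgt x y'; rewrite h ltxx.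
  + by move=> h; have := dgt x' y; rewrite h ltxx.
  + by move=> /mdist_positivity ->.
  + by move=> [->]; rewrite mdistxx.
- by move=> [x|y] [x'|y'] //=; rewrite metric_sym.
- move=> [x|y] [x'|y'] [x''|y''] //=; rewrite ?metric_triangle//.
  + by move: (d2 x'' x' y) (metric_sym x'' x'); lra.
  + by rewrite addrC; move: (d3 x'' y y') (metric_sym y y'); lra.
Qed.

(** The summands are at distance at least [eta], so a Cauchy sequence eventually stays in one of
    them. *)
Lemma complete_sum : complete_distance sum_dist.
Proof.
have [_ Xc _] := bf_polish X; have [_ Yc _] := bf_polish Y.
move=> u uC; have [N Nu] := uC _ eta0.
case uN : (u N) => [x0|y0].
- have uX n : (N <= n)%N -> exists x, u n = inl x.
    move=> /(Nu _ _ (leqnn N)); rewrite uN; case: (u n) => [x _|y /=];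
      first by exists x.
    by rewrite ltNge d_eta.
  (* The default [x0] can only occur before index [N]. *)
  pose v n := if u n is inl x then x else x0.
  have uv n : (N <= n)%N -> u n = inl (v n) by move=> /uX[x]; rewrite /v => ->.
  have [|l vl] := Xc v.
    move=> e /uC[M Me]; exists (maxn M N) => m n.
    rewrite !geq_max => /andP[Mm Nm] /andP[Mn Nn].
    by have := Me m n Mm Mn; rewrite !uv.
  exists (inl l) => e /vl[M Me]; exists (maxn M N) => n.
  by rewrite geq_max => /andP[/Me Mn /uv ->].
- have uY n : (N <= n)%N -> exists y, u n = inr y.
    move=> /(Nu _ _ (leqnn N)); rewrite uN; case: (u n) => [x /=|y _];
      last by exists y.
    by rewrite ltNge d_eta.
  pose v n := if u n is inr y then y else y0.
  have uv n : (N <= n)%N -> u n = inr (v n) by move=> /uY[y]; rewrite /v => ->.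
  have [|l vl] := Yc v.
    move=> e /uC[M Me]; exists (maxn M N) => m n.
    rewrite !geq_max => /andP[Mm Nm] /andP[Mn Nn].
    by have := Me m n Mm Mn; rewrite !uv.
  exists (inr l) => e /vl[M Me]; exists (maxn M N) => n.
  by rewrite geq_max => /andP[/Me Mn /uv ->].
Qed.

Lemma separable_sum : separable_distance sum_dist.
Proof.
have [_ _ [DX [f finj] DXd]] := bf_polish X;
  have [_ _ [DY [g ginj] DYd]] := bf_polish Y.
exists (fun s => match s with inl x => DX x | inr y => DY y end).
  exists (fun s => match s with inl x => (f x).*2 | inr y => (g y).*2.+1 end).
  move=> [x|y] [x'|y'] Ds Dt /=.
  - by move=> /double_inj /finj ->.
  - by move=> /(congr1 odd); rewrite /= !odd_double.
  - by move=> /(congr1 odd); rewrite /= !odd_double.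
  - by move=> [] /double_inj /ginj ->.
move=> [x|y] e e0.
  by have [x' Dx' xx'] := DXd x e e0; exists (inl x').
by have [y' Dy' yy'] := DYd y e e0; exists (inr y').
Qed.

Definition sum_space : pmetricType R := metric_on is_metric_sum (inl point).

Lemma polish_sum : is_polish_metric (@mdist R sum_space).
Proof. by split; [exact: is_metric_sum|exact: complete_sum|exact:
  separable_sum]. Qed.

Definition sum_proj (s : sum_space) : B :=
  match s with inl x => bf_proj x | inr y => bf_proj y end.

Lemma sum_proj_lip s t : mdist (sum_proj s) (sum_proj t) <= mdist s t.
Proof.
case: dP => d1 _ _ _ _.
case: s t => [x|y] [x'|y'] /=; rewrite ?bf_proj_lip//.
by rewrite metric_sym; exact: (d1 x' y).
Qed.

Definition sum_field : bField B := BField polish_sum sum_proj_lip.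

Lemma cross_metric_realized : exists (Z : bField B) (phi : X -> Z) (psi : Y ->
  Z),
  [/\ isometric_embedding phi, isometric_embedding psi
    & forall x y, mdist (phi x) (psi y) = delta x y].
Proof. by exists sum_field, inl, inr. Qed.

End disjoint_union.

Section dGP_gp_close.
Context {R : realType} {B : metricType R}.
Implicit Types X Y : mmField B.

Lemma cross_metric_shift X Y (delta : X -> Y -> R) eta : 0 <= eta ->
  cross_metric delta -> cross_metric (fun x y => delta x y + eta).
Proof.
move=> eta0 [d1 d2 d3 d4 d5]; split.
- by move=> x y; move: (d1 x y); lra.
- by move=> x x' y; move: (d2 x x' y); lra.
- by move=> x y y'; move: (d3 x y y'); lra.
- by move=> x x' y; move: (d4 x x' y); lra.
- by move=> x y y'; move: (d5 x y y'); lra.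
Qed.

Lemma mm_pushforwardE X (Z : bField B) (phi : X -> Z) (A : set (borel Z)) :
  isometric_embedding phi -> measurable A ->
  measurable (phi @^-1` A : set (borel X)) /\
  mm_pushforward phi A = (mass (phi @^-1` A))%:E.
Proof.
move=> [phiI _] mA.
have m : measurable (phi @^-1` A : set (borel X)).
  rewrite -[_ @^-1` _]setTI.
  by apply: (@measurable_lipschitz R X Z phi) => // x x'; rewrite phiI.
by split=> //; rewrite /mm_pushforward /pushforward PrE.
Qed.

Lemma open_thickening (Z : pmetricType R) (A : set Z) (e : R) : open
  (thickening A e).
Proof.
apply/open_metricP => z [a Aa az]; exists (e - mdist a z);
  first by rewrite subr_gt0.
by move=> z' zz'; exists a => //; have := metric_triangle a z z'; lra.
Qed.

(** The thickening, across the two embeddings, of the preimage of [A] in [X] lies in the preimage in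
    [Y] of the thickening of [A] in [Z]. *)
Lemma prokhorov_le X Y (Z : bField B) (phi : X -> Z) (psi : Y -> Z) (e : R) :
  isometric_embedding phi -> isometric_embedding psi -> 0 < e ->
  transports (fun x y => mdist (phi x) (psi y)) e ->
  transports (fun y x => mdist (phi x) (psi y)) e ->
  prokhorov (mm_pushforward phi) (mm_pushforward psi) <= e.
Proof.
move=> phiE psiE e0 t1 t2; apply: ge_inf.
  by exists 0 => r [/ltW].
split=> // A mA.
have [m1 E1] := mm_pushforwardE phiE mA.
have [m2 E2] := mm_pushforwardE psiE mA.
have mT : measurable (thickening A e : set (borel Z)).
  by apply: measurable_open; exact: open_thickening.
have [m3 E3] := mm_pushforwardE phiE mT.
have [m4 E4] := mm_pushforwardE psiE mT.
rewrite E1 E2 E3 E4 -!EFinD !lee_fin; split.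
  apply: le_trans (t1 _ m1) _; rewrite lerD2r; apply: le_Pr => //.
    apply: measurable_open; apply/open_metricP => y [x Ax xy].
    exists (e - mdist (phi x) (psi y)); first by rewrite subr_gt0.
    move=> y' yy'; exists x => //;
      have := metric_triangle (phi x) (psi y) (psi y').
    by case: psiE => -> _; lra.
  by move=> y [x Ax xy]; exists (phi x).
apply: le_trans (t2 _ m2) _; rewrite lerD2r; apply: le_Pr => //.
  apply: measurable_open; apply/open_metricP => x [y Ay xy].
  exists (e - mdist (phi x) (psi y)); first by rewrite subr_gt0.
  move=> x' xx'; exists y => //;
    have := metric_triangle (phi x') (phi x) (psi y).
  by case: phiE => -> _; rewrite (metric_sym x'); lra.
by move=> x [y Ay xy]; exists (psi y) => //; rewrite metric_sym.
Qed.

Lemma dGP_ge0 X Y : 0 <= dGP X Y.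
Proof.
rewrite /dGP; set S := [set _ | _].
(* The infimum of the empty set is 0, which settles the empty cases. *)
have [->|/set0P S0] := eqVneq S set0; first by rewrite inf0.
apply: lb_le_inf => // _ [Z [phi [psi [_ _ ->]]]].
rewrite /prokhorov; set S' := [set _ | _].
have [->|/set0P S0'] := eqVneq S' set0; first by rewrite inf0.
by apply: lb_le_inf => // r [/ltW].
Qed.

Lemma dGP_le X Y e : 0 < e -> gp_close X Y e -> dGP X Y <= e.
Proof.
(* [delta] may vanish; raising it by [eta] gives a true metric on the disjoint union. *)
move=> e0 [delta dP dt]; apply/ler_addgt0Pr => eta eta0.
have dP' := cross_metric_shift (ltW eta0) dP.
have [|Z [phi [psi [phiE psiE dE]]]] := cross_metric_realized dP' eta0.
  by move=> x y; rewrite lerDr (cross_metric_ge0 dP).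
(* Raising both [delta] and the radius by [eta] leaves the thickening unchanged. *)
have dt' : transports (fun x y => delta x y + eta) (e + eta).
  move=> A mA; apply: le_trans (dt A mA) _.
  apply: lerD; last by rewrite lerDl ltW.
  apply: le_Pr; [exact: measurable_thick..|].
  by move=> y [x Ax xy]; exists x => //; rewrite ltrD2r.
apply: (@le_trans _ _ (prokhorov (mm_pushforward phi) (mm_pushforward psi))).
  apply: ge_inf; last by exists Z, phi, psi.
  exists 0 => _ [Z' [phi' [psi' [_ _ ->]]]].
  rewrite /prokhorov; set S := [set _ | _].
  have [->|/set0P S0] := eqVneq S set0; first by rewrite inf0.
  by apply: lb_le_inf => // r [/ltW].
have dE' : (fun x y => mdist (phi x) (psi y)) = (fun x y => delta x y + eta).
  by apply/funext => x; apply/funext => y.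
apply: prokhorov_le => //.
- by rewrite addr_gt0.
- by rewrite dE'.
- rewrite (_ : (fun y x => mdist (phi x) (psi y)) = (fun y x => delta x y +
  eta)).
    exact: (transports_sym dP').
  by apply/funext => y; apply/funext => x.
Qed.

Lemma closure_metric (Z : pmetricType R) (A : set Z) (e : R) z : 0 < e ->
  closure A z -> exists2 a, A a & mdist z a < e.
Proof.
move=> e0 /(_ [set y | mdist z y < e])[].
  by apply/nbhs_ballP; exists e => //; rewrite ballEmdist.
by move=> a [Aa /= za]; exists a.
Qed.

(* Only closed sets need to be transported, and their images are closed. *)
Lemma gp_close_of_dGP X Y e : dGP X Y < e -> gp_close X Y e.
Proof.
move=> XYe; have [|_ [Z [phi [psi [phiE psiE ->]]]]] := inf_lt _ XYe.
  have [delta dP _] := gp_close1 X Y.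
  have [|Z [phi [psi [phiE psiE dE]]]] :=
      @cross_metric_realized _ _ _ _ _ _ (cross_metric_shift ler01 dP) ltr01.
    by move=> x y; rewrite lerDr (cross_metric_ge0 dP).
  by exists (prokhorov (mm_pushforward phi) (mm_pushforward psi)), Z, phi, psi.
have nonempty : [set r : R | 0 < r /\ forall A : set (borel Z), measurable A ->
    (mm_pushforward phi A <= mm_pushforward psi (thickening A r) + r%:E)%E /\
    (mm_pushforward psi A <= mm_pushforward phi (thickening A r) + r%:E)%E]
      !=set0.
  exists 1; split=> // A mA.
  have mT : measurable (thickening A 1 : set (borel Z)).
    by apply: measurable_open; exact: open_thickening.
  have [m1 ->] := mm_pushforwardE phiE mA;
    have [m2 ->] := mm_pushforwardE psiE mA.
  have [m3 ->] := mm_pushforwardE phiE mT;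
    have [m4 ->] := mm_pushforwardE psiE mT.
  by rewrite -!EFinD !lee_fin; split; apply: le_trans (Pr_le1 _ _) _;
    rewrite // lerDr Pr_ge0.
(* The gap between [e'] and [e] pays for the return from the closure of [A] to [A]. *)
move=> /(inf_lt nonempty)[e' [e'0 h] e'e].
exists (fun x y => mdist (phi x) (psi y)).
  case: phiE psiE => phiI phiB [psiI psiB]; split.
  - by move=> x y; rewrite -phiB -psiB bf_proj_lip.
  - by move=> x x' y; rewrite -phiI metric_triangle.
  - by move=> x y y'; rewrite -psiI metric_triangle.
  - by move=> x x' y; rewrite -phiI (metric_sym (phi x')) metric_triangle.
  - by move=> x y y'; rewrite -psiI (metric_sym (phi x)) metric_triangle.
move=> A mA; set C := closure A.
have cC : closed C by exact: closed_closure.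
have [_ Xc _] := bf_polish X.
have cF : closed (phi @` C) by apply: isometry_closed_image Xc _ cC; case: phiE.
have mF := measurable_closed cF.
have mT : measurable (thickening (phi @` C) e' : set (borel Z)).
  by apply: measurable_open; exact: open_thickening.
have [+ _] := h _ mF.
have [m1 ->] := mm_pushforwardE phiE mF;
  have [m2 ->] := mm_pushforwardE psiE mT.
rewrite -EFinD lee_fin => h'.
have AC : mass A <= mass (phi @^-1` (phi @` C)).
  by apply: le_Pr => // x Ax; exists x => //; exact: subset_closure.
apply: le_trans AC (le_trans h' _); apply: lerD (ltW e'e).
apply: le_Pr => //.
  apply: measurable_open; apply/open_metricP => y [x Ax xy].
  exists (e - mdist (phi x) (psi y)); first by rewrite subr_gt0.
  move=> y' yy'; exists x => //;
    have := metric_triangle (phi x) (psi y) (psi y').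
  by case: psiE => -> _; lra.
move=> y [_ [x Cx <-] xy].
have [|a Aa xa] := @closure_metric X A (e - e') x _ Cx;
  first by rewrite subr_gt0.
exists a => //; have := metric_triangle (phi a) (phi x) (psi y).
by case: phiE => -> _; rewrite (metric_sym a); lra.
Qed.

End dGP_gp_close.

(** * Fields at distance zero are isomorphic *)

(** The equation holds for all sets, so rewriting with it calls for no measurability proof. *)
Lemma law_probability (R : realType) d d' (T : measurableType d)
    (T' : measurableType d') (P : probability T R) (f : T -> T') :
  measurable_fun setT f ->
  exists Q : probability T' R, forall A, Q A = P (f @^-1` A).
Proof.
move=> mf; pose g : {mfun T >-> T'} := HB.pack f (isMeasurableFun.Build _ _ _ _
  f mf).
by exists (distribution P g).
Qed.

Section probability_estimates.
Context d (T : measurableType d) (R : realType) (P : probability T R).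
Implicit Types A K : set T.

Lemma Pr_setI_ge A K : measurable A -> measurable K ->
  Pr P A <= Pr P (A `&` K) + (1 - Pr P K).
Proof.
move=> mA mK; rewrite (PrDI P mA mK) addrC lerD2l -PrC//.
by apply: le_Pr; [exact: measurableD|exact: measurableC|move=> x []].
Qed.

Lemma Pr_meet A K : measurable A -> measurable K -> 1 < Pr P A + Pr P K ->
  A `&` K !=set0.
Proof.
move=> mA mK h; apply/set0P/negP => /eqP AK0.
by have := Pr_setI_ge mA mK; rewrite AK0 Pr0; lra.
Qed.

Lemma Pr_gt0_nonempty A : 0 < Pr P A -> A !=set0.
Proof. by move=> h; apply/set0P/negP => /eqP A0; move: h;
  rewrite A0 Pr0 ltxx. Qed.

End probability_estimates.

Section ultrafilter.
Context (R : realType) (U : set_system nat) (UU : UltraFilter U).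

(** The limit is the infimum of the levels below which [u] lies [U]-almost always. A level under it
    is not of this kind, so by the ultrafilter property [u] exceeds it [U]-almost always. *)
Lemma ultra_limit (u : nat -> R) (a b : R) :
  U [set n | a <= u n] -> U [set n | u n <= b] ->
  exists l, forall e : R, 0 < e -> U [set n | `|u n - l| < e].
Proof.
move=> Ua Ub; pose S := [set t | U [set n | u n <= t]].
have Sinf : has_inf S.
  split; first by exists b.
  exists a => t St; have [n [/= an nt]] := filter_ex (filterI Ua St).
  exact: le_trans nt.
exists (inf S) => e e0.
have [t St te] := inf_adherent e0 Sinf.
have Se : U [set n | inf S - e < u n].
  have [h|h] := in_ultra_setVsetC [set n | u n <= inf S - e] UU.
    have := ge_inf Sinf.2 h; lra.
  by apply: filterS h => n /=; move=> /negP; rewrite -ltNge.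
apply: filterS (filterI St Se) => n [/= h1 h2].
by rewrite ltr_norml; apply/andP; split; lra.
Qed.

Lemma filter_forall_ltn (F : nat -> set nat) N :
  (forall i, U (F i)) -> U [set n | forall i, (i < N)%N -> F i n].
Proof.
move=> UF; elim: N => [|N ih];
  first by apply: filterS (@filterT _ U _) => n _ i.
apply: filterS (filterI ih (UF N)) => n [h FN] i.
by rewrite ltnS leq_eqVlt => /orP[/eqP ->|/h].
Qed.

End ultrafilter.

Section finite_approximation.
Context {R : realType} {B : metricType R} (X : mmField B).

Definition ball_union (u : nat -> X) (e : R) (N : nat) : set X :=
  [set x | exists2 i, (i < N)%N & mdist x (u i) < e].

Lemma open_ball_union u e N : open (ball_union u e N).
Proof.
apply/open_metricP => x [i iN xi]; exists (e - mdist x (u i));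
  first by rewrite subr_gt0.
move=> y xy; exists i => //.
by move: (metric_triangle y x (u i)) (metric_sym x y); lra.
Qed.

(** The substitute for tightness: at each scale, finitely many balls carry almost all the mass. *)
Lemma ball_union_mass (u : nat -> X) (e eta : R) :
  (forall x (e : R), 0 < e -> exists k, mdist x (u k) < e) -> 0 < e -> 0 < eta
    ->
  exists N, 1 - eta < mass (ball_union u e N).
Proof.
move=> ud e0 eta0.
have [|||N h] := @Pr_bigcup_gt _ _ _ (@mm_measure R B X) (ball_union u e) (1 -
  eta).
- by move=> n; apply: measurable_open; exact: open_ball_union.
- by move=> n m nm x [i iN xi]; exists i => //; exact: leq_trans nm.
- rewrite (_ : \bigcup_n _ = setT) ?PrT; first lra.
  apply/seteqP; split=> // x _; have [k xk] := ud x e e0.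
  by exists k.+1 => //; exists k.
- by exists N.
Qed.

Lemma bounded_ball_mass (x : X) (eta : R) : 0 < eta ->
  exists r, 1 - eta < mass [set y : X | mdist x y < r].
Proof.
move=> eta0.
have [|||N h] := @Pr_bigcup_gt _ _ _ (@mm_measure R B X)
    (fun n => [set y : X | mdist x y < n%:R]) (1 - eta).
- by move=> n; exact: measurable_metric_ball.
- by move=> n m nm y /lt_le_trans; apply; rewrite ler_nat.
- rewrite (_ : \bigcup_n _ = setT) ?PrT; first lra.
  apply/seteqP; split=> // y _.
  by exists (Num.truncn (mdist x y)).+1 => //=; exact: truncnS_gt.
- by exists N%:R.
Qed.

Lemma fully_supported_mass x e : fully_supported X -> 0 < e ->
  0 < mass [set y : X | mdist x y < e].
Proof.
move=> /seteqP[_ /(_ x I)] h e0.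
have := h _ (open_metric_ball x e); rewrite /= mdistxx => /(_ e0).
by rewrite PrE ?lte_fin//; exact: measurable_metric_ball.
Qed.

(** A closed set is the intersection of its thickenings, and the mass is continuous from above. *)
Lemma mass_closed_ge (C : set X) (a : R) : closed C ->
  (forall e : R, 0 < e -> a <= mass [set y : X | exists2 x, C x & mdist x y <
    e] + e) ->
  a <= mass C.
Proof.
move=> cC h; rewrite leNgt; apply/negP => Ca.
pose F n := [set y : X | exists2 x, C x & mdist x y < invS R n].
have mF n : measurable (F n : set (borel X)).
  by apply: measurable_open; exact: (@open_thickening R X).
have Fle n m : (n <= m)%N -> F m `<=` F n.
  move=> nm y [x Cx xy]; exists x => //; apply: lt_le_trans xy _.
  exact: le_invS.
have FC : \bigcap_n F n = C.
  apply/seteqP; split=> [y Fy|y Cy n _]; last by exists y => //;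
    rewrite mdistxx invS_gt0.
  move/closed_metricP : cC; apply => e /invS_lt[N Ne].
  have [x Cx xy] := Fy N I; exists x => //.
  by rewrite metric_sym; apply: lt_trans xy (Ne _ _).
(* Half of the gap between [mass C] and [a] is kept for the error term [e]. *)
have [|n Fn] := @Pr_bigcap_lt _ _ _ (@mm_measure R B X) F ((mass C + a) / 2) mF
  Fle.
  by rewrite FC -/(mass C); lra.
have [|M Me] := @invS_lt R ((a - mass C) / 2); first lra.
have := h _ (invS_gt0 R (maxn n M)); rewrite -/(F _).
have := Me _ (leq_maxr n M).
have := le_Pr (@mm_measure R B X) (mF _) (mF _) (Fle _ _ (leq_maxl n M)).
by rewrite /mass in Fn *; lra.
Qed.

End finite_approximation.

Section limit_metric.
Context {R : realType} {B : metricType R} (X Y : mmField B).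
Hypothesis Xs : fully_supported X.
Variable delta : nat -> X -> Y -> R.
Hypotheses (dP : forall n, cross_metric (delta n))
  (dt : forall n, transports (delta n) (invS R n)).

(** By full support the unit ball at [x] has mass [a > 0]. Its transported image has mass above
    [a / 2], so it meets a fixed ball at [y] of mass above [1 - a / 2]. *)
Lemma cross_metrics_bounded x y :
  exists N r, forall n, (N <= n)%N -> delta n x y <= r.
Proof.
have := fully_supported_mass x Xs ltr01.
set a := mass _ => a0.
have [|r hr] := bounded_ball_mass y (_ : 0 < a / 2); first lra.
(* 1 bounds the distance across, [a / 2] the loss of mass. *)
have [|N Na] := @invS_lt R (Num.min 1 (a / 2)); first by rewrite lt_min; lra.
exists N, (1 + 1 + r) => n /Na; rewrite lt_min => /andP[n1 na].
have mb := @measurable_metric_ball R X x 1.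
have := dt n mb; rewrite -/(mass _) -/a => h.
have [y' [[x' /= xx' xy'] /= yy']] :
    thick (delta n) [set y | mdist x y < 1] (invS R n) `&` [set z | mdist y z <
      r] !=set0.
  apply: (@Pr_meet _ _ _ (@mm_measure R B Y)).
  - exact: measurable_thick.
  - exact: (@measurable_metric_ball R Y y r).
  - by move: h hr; rewrite /mass; lra.
case: (dP n) => _ d2 d3 _ _.
move: (d2 x x' y) (d3 x' y y') (metric_sym y y'); lra.
Qed.

(** The inequalities of a cross metric pass to pointwise limits; transport needs some uniformity. Up
    to a small mass, finitely many balls suffice, and since [d] and [delta n] are 1-Lipschitz in
    each variable, closeness at pairs of centres extends to pairs of balls. *)
Lemma limit_cross_metric : exists2 d : X -> Y -> R, cross_metric d &
  forall e : R, 0 < e -> transports d e.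
Proof.
have [U [UU Uoo]] := @ultraFilterLemma nat \oo _.
have UN N : U [set n | (N <= n)%N] by apply: Uoo; exists N.
have lim x y : exists l, forall e : R, 0 < e -> U [set n | `|delta n x y - l| <
  e].
  have [N [r rN]] := cross_metrics_bounded x y.
  apply: (@ultra_limit R U UU _ 0 r).
    by apply: filterS (UN 0%N) => n _; exact: cross_metric_ge0.
  by apply: filterS (UN N) => n /rN.
pose d x y := sval (cid (lim x y)).
have dlim x y (e : R) : 0 < e -> U [set n | `|delta n x y - d x y| < e].
  exact: (svalP (cid (lim x y))).
have dlim2 x y x' y' (e : R) : 0 < e -> exists n,
    `|delta n x y - d x y| < e /\ `|delta n x' y' - d x' y'| < e.
  by move=> e0; have [n] := filter_ex (filterI (dlim x y e e0) (dlim x' y' e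
    e0)); exists n.
have cd : cross_metric d.
  split.
  - move=> x y; apply/ler_addgt0Pr => e e0;
    have [n [+ _]] := dlim2 x y x y e e0.
    rewrite ltr_norml => /andP[_]; case: (dP n) => /(_ x y) + _ _ _ _; lra.
  - move=> x x' y; apply/ler_addgt0Pr => e e0.
    have [|n []] := dlim2 x y x' y (e / 2); first lra.
    rewrite !ltr_norml => /andP[? ?] /andP[? ?].
    case: (dP n) => _ /(_ x x' y) + _ _ _; lra.
  - move=> x y y'; apply/ler_addgt0Pr => e e0.
    have [|n []] := dlim2 x y x y' (e / 2); first lra.
    rewrite !ltr_norml => /andP[? ?] /andP[? ?].
    case: (dP n) => _ _ /(_ x y y') + _ _; lra.
  - move=> x x' y; apply/ler_addgt0Pr => e e0.
    have [|n []] := dlim2 x y x' y (e / 2); first lra.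
    rewrite !ltr_norml => /andP[? ?] /andP[? ?].
    case: (dP n) => _ _ _ /(_ x x' y) + _; lra.
  - move=> x y y'; apply/ler_addgt0Pr => e e0.
    have [|n []] := dlim2 x y x y' (e / 2); first lra.
    rewrite !ltr_norml => /andP[? ?] /andP[? ?].
    case: (dP n) => _ _ _ _ /(_ x y y'); lra.
exists d => // e e0 A mA.
have [u ud] := separable_dense_sequence (bf_polish X).
have [v vd] := separable_dense_sequence (bf_polish Y).
(* Six errors of [e / 8] add up in the distance: the radius, the comparison at the centres, and two
   moves to a centre on each side. Three add up in the mass. *)
have e80 : 0 < e / 8 by lra.
have [N hN] := ball_union_mass ud e80 e80.
have [M hM] := ball_union_mass vd e80 e80.
have [L Le] := invS_lt e80.
have Uij : U [set n | forall i, (i < N)%N -> forall j, (j < M)%N ->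
    `|delta n (u i) (v j) - d (u i) (v j)| < e / 8].
  apply: filter_forall_ltn => i; apply: filter_forall_ltn => j; exact: dlim.
have [n [/= hn /Le Ln]] := filter_ex (filterI Uij (UN L)).
set K := ball_union u _ N in hN; set K' := ball_union v _ M in hM.
have mK : measurable (K : set (borel X)) by apply: measurable_open;
  exact: open_ball_union.
have mK' : measurable (K' : set (borel Y)) by apply: measurable_open;
  exact: open_ball_union.
have mAK : measurable (A `&` K) by exact: measurableI.
have h1 := Pr_setI_ge (@mm_measure R B X) mA mK.
have h2 := dt n mAK.
have mT := measurable_thick (dP n) (A `&` K) (invS R n).
have h3 := Pr_setI_ge (@mm_measure R B Y) mT mK'.
have h4 : mass (thick (delta n) (A `&` K) (invS R n) `&` K') <= mass (thick d A
  e).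
  apply: le_Pr; [exact: measurableI|exact: measurable_thick|].
  move=> y [[x [Ax [i iN xi]] xy] [j jM yj]]; exists x => //.
  have := hn i iN j jM; rewrite ltr_norml => /andP[c1 c2].
  case: (dP n) => _ d2 d3 _ _; case: cd => _ d2' d3' _ _.
  move: (d2 (u i) x (v j)) (d3 x (v j) y) (d2' x (u i) y) (d3' (u i) y (v j)).
  move: (metric_sym (u i) x) (metric_sym (v j) y); lra.
move: h1 h2 h3 h4 hN hM; rewrite /mass; lra.
Qed.

End limit_metric.

Section zero_distance.
Context {R : realType} {B : metricType R}.

(** Small balls at [x] have positive mass and are transported into sets of positive mass, which
    gives points of [Y] ever closer to [x]. They form a Cauchy sequence by the last inequality of
    [cross_metric]. *)
Lemma cross_metric_partner (X Y : mmField B) (d : X -> Y -> R) x :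
  fully_supported X -> cross_metric d -> (forall e : R, 0 < e -> transports d
    e) ->
  exists y, d x y = 0.
Proof.
move=> Xs dP dt.
have close (e : R) : 0 < e -> exists y, d x y < e.
  move=> e0; have e20 : 0 < e / 2 by lra.
  have a0 := fully_supported_mass x Xs e20.
  set A := [set y | _] in a0.
  (* An error below the mass of the ball makes the target set nonempty. *)
  have e'0 : 0 < Num.min (e / 2) (mass A / 2) by rewrite lt_min; lra.
  have := dt _ e'0 A (measurable_metric_ball x (e / 2)) => h.
  have [|y [x' xx']] :=
      @Pr_gt0_nonempty _ _ _ (@mm_measure R B Y) (thick d A (Num.min (e / 2)
        (mass A / 2))).
    have : Num.min (e / 2) (mass A / 2) <= mass A / 2 by rewrite ge_min lexx
      orbT.
    by move: h; rewrite /mass; lra.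
  rewrite /A /= in xx'; rewrite lt_min => /andP[x'y _]; exists y.
  by case: dP => _ d2 _ _ _; move: (d2 x x' y); lra.
have /choice[v vP] n : exists y, d x y < invS R n
  by exact: close (invS_gt0 R n).
have vlt (e : R) : 0 < e -> exists N, forall n, (N <= n)%N -> d x (v n) < e.
  by move=> /invS_lt[N Ne]; exists N => n /Ne; exact: lt_trans.
case: (dP) => _ _ d3 _ d5.
have [_ Yc _] := bf_polish Y.
have [l vl] : exists l, converges_to (@mdist R Y) v l.
  apply: Yc => e e0; have [|N Ne] := vlt (e / 2); first lra.
  by exists N => m n /Ne dm /Ne dn; move: (d5 x (v m) (v n)); lra.
exists l; apply/eqP; rewrite eq_le (cross_metric_ge0 dP) andbT.
apply/ler_addgt0Pr => e e0; rewrite add0r.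
have [|N Ne] := vlt (e / 2); first lra.
have [|M Me] := vl (e / 2); first lra.
have := Ne _ (leq_maxl N M); have := Me _ (leq_maxr N M).
by move: (d3 x l (v (maxn N M))); lra.
Qed.

Lemma gp_close_isomorphic (X Y : mmField B) :
  fully_supported X -> fully_supported Y ->
  (forall e : R, 0 < e -> gp_close X Y e) -> mm_isomorphic X Y.
Proof.
move=> Xs Ys XY.
have /choice[delta deltaP] n : exists delta : X -> Y -> R,
    cross_metric delta /\ transports delta (invS R n).
  by have [delta] := XY _ (invS_gt0 R n); exists delta.
have [d dP dt] := limit_cross_metric Xs (fun n => (deltaP n).1) (fun n =>
  (deltaP n).2).
have dt' (e : R) : 0 < e -> transports (fun y x => d x y) e.
  by move=> e0; apply: transports_sym => //; exact: dt.
have /choice[phi phiP] x := cross_metric_partner x Xs dP dt.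
have /choice[psi psiP] y := cross_metric_partner y Ys (cross_metric_sym dP) dt'.
case: (dP) => d1 d2 d3 d4 d5.
have phiI x x' : mdist (phi x) (phi x') = mdist x x'.
  apply/eqP; rewrite eq_le; apply/andP; split.
    move: (d5 x (phi x) (phi x')) (d2 x x' (phi x')).
    by rewrite !phiP; lra.
  move: (d4 x x' (phi x)) (d3 x' (phi x) (phi x')).
  by rewrite !phiP metric_sym (metric_sym (phi x')); lra.
have d0 (y y' : Y) : mdist y y' <= 0 -> y = y'.
  by move=> h; apply: mdist_positivity; apply/eqP; rewrite eq_le h mdist_ge0.
have d0' (x x' : X) : mdist x x' <= 0 -> x = x'.
  by move=> h; apply: mdist_positivity; apply/eqP; rewrite eq_le h mdist_ge0.
have phiE : isometric_embedding phi.
  split=> // x; apply: mdist_positivity; apply/eqP.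
  by rewrite eq_le mdist_ge0 andbT metric_sym -(phiP x) d1.
exists phi; split=> //.
  exists psi => [x|y].
    by apply: d0'; move: (d4 (psi (phi x)) x (phi x)); rewrite phiP psiP addr0.
  by apply: d0; move: (d5 (psi y) (phi (psi y)) y); rewrite phiP psiP addr0.
have mphi : measurable_fun setT (phi : borel X -> borel Y).
  by apply: measurable_lipschitz => x x'; rewrite phiI.
(* As [d x (phi x) = 0], thickenings across [d] become ordinary ones after applying [phi] or [psi].
   On closed sets, [mass_closed_ge] then removes all errors. *)
have closedE (C : set Y) : closed C -> mass (phi @^-1` C) = mass C.
  move=> cC; have cC' : closed (phi @^-1` C).
    rewrite -openC preimage_setC; apply: lipschitz_preimage_open;
      last by rewrite openC.
    by move=> x x'; rewrite phiI.
  apply/eqP; rewrite eq_le; apply/andP; split; apply: mass_closed_ge => // e e0.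
    apply: le_trans (dt e e0 _ (measurable_closed cC')) _.
    rewrite lerD2r; apply: le_Pr; first exact: measurable_thick.
      apply: measurable_open; exact: (@open_thickening R Y).
    move=> y [x Cx xy]; exists (phi x) => //.
    by move: (d5 x (phi x) y); rewrite phiP; lra.
  apply: le_trans (dt' e e0 _ (measurable_closed cC)) _.
  rewrite lerD2r; apply: le_Pr.
  - exact: (measurable_thick (cross_metric_sym dP)).
  - by apply: measurable_open; exact: (@open_thickening R X).
  - move=> x [y Cy xy]; exists (psi y); last by move: (d4 (psi y) x y);
    rewrite psiP; lra.
    rewrite /preimage /= (_ : phi (psi y) = y)//; apply: d0.
    by move: (d5 (psi y) (phi (psi y)) y); rewrite phiP psiP addr0.
have [Q QE] := law_probability (@mm_measure R B X) mphi.
move=> A mA; rewrite /mm_pushforward /pushforward -QE.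
(* Open sets are stable under intersection and generate the Borel sets; on them equality follows by
   complement. *)
apply: (@measure_unique _ _ (borel Y) (@open Y) (fun=> setT)) => //.
- exact: openI.
- by move=> _; exact: openT.
- by rewrite bigcup_const//; exists 0%N.
- move=> U oU; have mU := measurable_open oU.
  have mpU : measurable (phi @^-1` U : set (borel X)).
    by rewrite -[_ @^-1` _]setTI; exact: mphi.
  apply: (eq_trans (QE U)); apply: (eq_trans (PrE (@mm_measure R B X) mpU)).
  apply: (eq_trans _ (esym (PrE (@mm_measure R B Y) mU))); congr (_%:E).
  have := closedE (~` U); rewrite closedC => /(_ oU).
  by rewrite -preimage_setC /mass !PrC//; lra.
- by move=> _; rewrite -ge0_fin_numE// fin_num_measure.
Qed.

Lemma isomorphic_gp_close (X Y : mmField B) (e : R) : 0 < e ->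
  mm_isomorphic X Y -> gp_close X Y e.
Proof.
move=> e0 [phi [[psi phiK psiK] [phiI phiB] phiM]].
exists (fun x y => mdist (phi x) y).
  split.
  - by move=> x y; rewrite -phiB bf_proj_lip.
  - by move=> x x' y; rewrite -phiI metric_triangle.
  - by move=> x y y'; rewrite metric_triangle.
  - by move=> x x' y; rewrite -phiI (metric_sym (phi x')) metric_triangle.
  - by move=> x y y'; rewrite (metric_sym (phi x)) metric_triangle.
move=> A mA.
have psiI y y' : mdist (psi y) (psi y') = mdist y y' by rewrite -phiI !psiK.
(* The image of [A] under [phi] is measurable as a preimage under its inverse. *)
have mA' : measurable (psi @^-1` A : set (borel Y)).
  rewrite -[_ @^-1` _]setTI.
  by apply: (@measurable_lipschitz R Y X psi) => // y y'; rewrite psiI.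
have -> : mass A = mass (psi @^-1` A).
  rewrite /mass /Pr -(phiM _ mA') /mm_pushforward /pushforward;
    congr (fine (_ _)).
  by apply/seteqP; split=> x; rewrite /preimage /= phiK.
rewrite -[leLHS]addr0; apply: lerD (ltW e0); apply: le_Pr => //.
  apply: measurable_open; apply/open_metricP => y [x Ax xy].
  exists (e - mdist (phi x) y); first by rewrite subr_gt0.
  by move=> z yz; exists x => //; have := metric_triangle (phi x) y z; lra.
by move=> y Ay; exists (psi y) => //; rewrite psiK mdistxx.
Qed.

End zero_distance.

(** * Separability *)

(** One representative per nonempty fibre of each code gives a countable dense set. [rep] is
    option-valued because a pair need not be attained. *)
Lemma separable_of_codes (R : realType) (T : Type) (d : T -> T -> R) :
  (forall e : R, 0 < e -> exists c : T -> nat, forall x y, c x = c y -> d x y <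
    e) ->
  separable_distance d.
Proof.
move=> codes.
have /choice[c cP] k : exists c : T -> nat, forall x y, c x = c y -> d x y <
  invS R k.
  exact: codes (invS_gt0 R k).
pose rep (p : nat * nat) : option T :=
  if pselect (exists x, c p.1 x = p.2) is left h then Some (sval (cid h)) else
    None.
pose index x := if pselect (exists p, rep p = Some x) is left h
  then pickle (sval (cid h)) else 0%N.
exists (fun x => exists p, rep p = Some x).
  exists index => x y hx hy; rewrite /index.
  case: pselect => // hx'; case: pselect => // hy'.
  case: (cid hx') => p /= px; case: (cid hy') => q /= qy.
  by move=> /(pcan_inj pickleK) pq; move: px; rewrite pq qy => -[].
move=> x e /invS_lt[k /(_ k (leqnn k)) ke].
have : rep (k, c k x) <> None.
  by rewrite /rep; case: pselect => //= -[]; exists x.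
case E : (rep _) => [y|//] _; exists y; first by exists (k, c k x).
apply: lt_trans ke; apply: cP; move: E; rewrite /rep;
  case: pselect => // h [<-].
by case: (cid h).
Qed.

Lemma truncn_eq_dist (R : realType) (a b : R) : 0 <= a -> 0 <= b ->
  Num.truncn a = Num.truncn b -> a < b + 1.
Proof.
move=> /truncn_itv/andP[_ a1] /truncn_itv/andP[b1 _] ab.
by apply: lt_le_trans a1 _; rewrite ab -natr1 lerD2r.
Qed.

Lemma eq_mkseq_nth (T : Type) (f g : nat -> T) N i :
  mkseq f N = mkseq g N -> (i < N)%N -> f i = g i.
Proof.
move=> fg iN; have := congr1 (fun s => nth (f 0%N) s i) fg.
by rewrite !nth_mkseq.
Qed.

Section cells.
Context {R : realType} {B : metricType R} (X : mmField B).
Implicit Type u : nat -> X.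

(** The balls made disjoint: each point goes to the first centre within [e]. *)
Definition cell u (e : R) i : set X :=
  [set x | mdist x (u i) < e /\ forall j, (j < i)%N -> e <= mdist x (u j)].

Lemma measurable_cell u e i : measurable (cell u e i : set (borel X)).
Proof.
rewrite (_ : cell u e i = [set x | mdist x (u i) < e] `\` ball_union u e i).
  apply: measurableD; last by apply: measurable_open; exact: open_ball_union.
  rewrite (_ : [set x | _] = [set x | mdist (u i) x < e]).
    exact: (@measurable_metric_ball R X).
  by apply/seteqP; split=> x /=; rewrite metric_sym.
apply/seteqP; split=> x /= [xi h]; split=> //.
  by move=> [j ji xj]; have := h j ji; rewrite leNgt xj.
by move=> j ji; rewrite leNgt; apply/negP => xj; apply: h; exists j.
Qed.

Lemma cell_disjoint u e i j x : cell u e i x -> cell u e j x -> i = j.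
Proof.
move=> [xi hi] [xj hj]; case: (ltngtP i j) => // ij.
  by have := hj _ ij; rewrite leNgt xi.
by have := hi _ ij; rewrite leNgt xj.
Qed.

Lemma ball_union_cell u e N x : ball_union u e N x ->
  exists2 i, (i < N)%N & cell u e i x.
Proof.
move=> [i iN xi]; have ex : exists j, mdist x (u j) < e by exists i.
exists (ex_minn ex); first by case: ex_minnP => m _ /(_ i xi) /leq_ltn_trans;
  apply.
case: ex_minnP => m xm mmin; split=> // j jm; rewrite leNgt;
  apply/negP => /mmin.
by rewrite leqNgt jm.
Qed.

End cells.

Section codes.
Context {R : realType} {B : metricType R}.

(** [A] is replaced by the cells that it meets. The rounding of the [N] masses costs [e] in total,
    and the points outside all cells cost another [e]. *)
Lemma transports_cells (X Y : mmField B) (u : nat -> X) (v : nat -> Y)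
    (delta : X -> Y -> R) (N : nat) (e r : R) :
  cross_metric delta -> 1 - e < mass (ball_union u e N) ->
  (forall i, (i < N)%N -> mass (cell u e i) <= mass (cell v e i) + e / N%:R) ->
  (forall i x y, (i < N)%N -> cell u e i x -> cell v e i y -> delta x y < r) ->
  e *+ 2 <= r -> transports delta r.
Proof.
move=> dP uN uv duv er A mA.
pose Q i := `[< A `&` cell u e i !=set0 >].
have mK : measurable (ball_union u e N : set (borel X)).
  by apply: measurable_open; exact: open_ball_union.
have [mS ES] := Pr_disjoint_sum (@mm_measure R B X) N Q
  (measurable_cell u e) (@cell_disjoint _ _ _ u e).
have [mS' ES'] := Pr_disjoint_sum (@mm_measure R B Y) N Q
  (measurable_cell v e) (@cell_disjoint _ _ _ v e).
have h1 := Pr_setI_ge (@mm_measure R B X) mA mK.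
have h2 : Pr (@mm_measure R B X) (A `&` ball_union u e N) <=
    \sum_(i < N | Q i) mass (cell u e i).
  rewrite -ES; apply: le_Pr => //; first exact: measurableI.
  move=> x [Ax /ball_union_cell[i iN xi]]; exists i; split=> //.
  by apply/asboolP; exists x.
have h3 : \sum_(i < N | Q i) mass (cell v e i) <= mass (thick delta A r).
  rewrite -ES'; apply: le_Pr => //; first exact: measurable_thick.
  move=> y [i [iN /asboolP[x [Ax xi]] yi]]; exists x => //.
  exact: duv yi.
have e0 : 0 <= e.
  by have := Pr_le1 (@mm_measure R B X) mK; move: uN; rewrite /mass; lra.
have h4 : \sum_(i < N | Q i) mass (cell u e i) <= \sum_(i < N | Q i) mass (cell
  v e i) + e.
  apply: (@le_trans _ _ (\sum_(i < N | Q i) (mass (cell v e i) + e / N%:R))).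
    by apply: ler_sum => i _; exact: uv.
  rewrite big_split/= lerD2l.
  apply: (@le_trans _ _ (\sum_(i < N) (e / N%:R))).
    by rewrite big_mkcond/=; apply: ler_sum => i _; case: ifP => // _;
      rewrite divr_ge0.
  rewrite sumr_const card_ord -(mulr_natr (e / _)); case: (N) => [|n];
    first by rewrite mulr0.
  by rewrite divfK// pnatr_eq0.
by move: uN h1 h2 h3 h4; rewrite /mass; lra.
Qed.

Lemma field_codes (e : R) : is_polish_metric (@mdist R B) -> 0 < e ->
  exists c : mmField B -> nat, forall X Y, c X = c Y -> gp_close X Y e.
Proof.
(* Points of matching cells are at distance below [h + (h + h) + h]: two radii, and an edge of
   length [h + h] because both projections are within [h] of the same point of [B]. The bound 1/2
   makes the mass of the cells positive, so there is at least one. *)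
move=> Bpol e0; pose h := Num.min (e / 4) (1 / 2).
have h0 : 0 < h by rewrite lt_min; lra.
have he : h <= e / 4 by rewrite ge_min lexx.
have h1 : h <= 1 / 2 by rewrite ge_min lexx orbT.
(* [B] may be empty; a field supplies the point needed to enumerate it. *)
have [[X0]|nX] := pselect (exists X : mmField B, True); last first.
  by exists (fun=> 0%N) => X; exfalso; apply: nX; exists X.
have [b bd] : exists b : nat -> B,
    forall x (e : R), 0 < e -> exists k, mdist x (b k) < e.
  by case: Bpol => _ _; exact: (dense_sequence (bf_proj (point : X0))).
have dataP (X : mmField B) : exists p : nat * (nat -> X) * (nat -> nat),
    1 - h < mass (ball_union p.1.2 h p.1.1) /\
    forall i, mdist (bf_proj (p.1.2 i)) (b (p.2 i)) < h.
  have [u ud] := separable_dense_sequence (bf_polish X).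
  have [N uN] := ball_union_mass ud h0 h0.
  have /choice[k kP] i : exists k, mdist (bf_proj (u i)) (b k) < h by exact: bd.
  by exists (N, u, k).
pose data X := sval (cid (dataP X)).
have dataE X : 1 - h < mass (ball_union (data X).1.2 h (data X).1.1) /\
    forall i, mdist (bf_proj ((data X).1.2 i)) (b ((data X).2 i)) < h.
  exact: (svalP (cid (dataP X))).
pose size X := (data X).1.1; pose pts X := (data X).1.2;
  pose idx X := (data X).2.
pose code X := (size X,
  mkseq (fun i => mkseq (fun j => Num.truncn (mdist (pts X i) (pts X j) / h))
    (size X)) (size X),
  mkseq (idx X) (size X),
  mkseq (fun i => Num.truncn (mass (cell (pts X) h i) / (h / (size X)%:R)))
    (size X)).
exists (fun X => pickle (code X)) => X Y /(pcan_inj pickleK);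
  rewrite /code => -[].
have [Xm Xb] := dataE X; have [Ym Yb] := dataE Y.
rewrite -/(size X) -/(pts X) -/(idx X) in Xm Xb.
rewrite -/(size Y) -/(pts Y) -/(idx Y) in Ym Yb.
set N := size X => NE; rewrite -NE => dE iE mE.
have N0 : (0 < N)%N.
  have [|x [i iN _]] := @Pr_gt0_nonempty _ _ _ (@mm_measure R B X) (ball_union
    (pts X) h N).
    by move: Xm; rewrite /mass; lra.
  exact: leq_ltn_trans iN.
have divh0 (x : R) : 0 <= x -> 0 <= x / h by move=> ?; rewrite divr_ge0// ltW.
have dXY (i j : 'I_N) : mdist (pts X i) (pts X j) <= mdist (pts Y i) (pts Y j)
  + h.
  have := eq_mkseq_nth (eq_mkseq_nth dE (ltn_ord i)) (ltn_ord j).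
  move=> /(truncn_eq_dist (divh0 _ (mdist_ge0 _ _)) (divh0 _ (mdist_ge0 _ _))).
  by rewrite ltr_pdivrMr// mulrDl mul1r divfK ?gt_eqF// => /ltW.
have dYX (i j : 'I_N) : mdist (pts Y i) (pts Y j) <= mdist (pts X i) (pts X j)
  + h.
  have := eq_mkseq_nth (eq_mkseq_nth (esym dE) (ltn_ord i)) (ltn_ord j).
  move=> /(truncn_eq_dist (divh0 _ (mdist_ge0 _ _)) (divh0 _ (mdist_ge0 _ _))).
  by rewrite ltr_pdivrMr// mulrDl mul1r divfK ?gt_eqF// => /ltW.
pose uX (i : 'I_N) := pts X i; pose uY (i : 'I_N) := pts Y i.
have abB i : mdist (bf_proj (uX i)) (bf_proj (uY i)) <= h + h.
  have := eq_mkseq_nth iE (ltn_ord i) => ii; have := Yb i; have := Xb i;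
    rewrite -ii.
  by move: (metric_triangle (bf_proj (uX i)) (b (idx X i)) (bf_proj (uY i)))
    (metric_sym (b (idx X i)) (bf_proj (uY i))); rewrite /uX /uY; lra.
have dP : cross_metric (cross_of_pairs uX uY (h + h)).
  apply: (cross_metric_of_pairs (Ordinal N0)) => //.
    by move=> i j; move: (dXY i j); rewrite /uX /uY; lra.
  by move=> i j; move: (dYX i j); rewrite /uX /uY; lra.
exists (cross_of_pairs uX uY (h + h)) => //.
apply: (@transports_cells X Y (pts X) (pts Y) _ N h e) => //; last by lra.
  move=> i iN; have t0 : 0 < h / N%:R by rewrite divr_gt0// ltr0n.
  have := truncn_eq_dist (divr_ge0 (Pr_ge0 _ _) (ltW t0)) (divr_ge0 (Pr_ge0 _
    _) (ltW t0))
    (eq_mkseq_nth mE iN).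
  by rewrite ltr_pdivrMr// mulrDl mul1r divfK ?gt_eqF// => /ltW.
move=> i x y iN [xi _] [yi _].
apply: (le_lt_trans (cross_of_pairs_le abB x y (Ordinal iN))).
by rewrite /uX /uY/=; move: (metric_sym (pts Y i) y); lra.
Qed.

End codes.

(** * Couplings of finite distributions *)

Section weighted_hall.
Context (R : realFieldType) (I J : finType) (E : I -> J -> bool).
Implicit Types (p : I -> R) (q : J -> R) (A : {set I}) (w : I -> J -> R).

Definition nb A : {set J} := [set j | [exists i in A, E i j]].

Definition hall p q := forall A, \sum_(i in A) p i <= \sum_(j in nb A) q j.

Definition flow p q w :=
  [/\ forall i j, 0 <= w i j, forall i j, ~~ E i j -> w i j = 0,
      forall i, \sum_j w i j = p i & forall j, \sum_i w i j <= q j].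

Definition supp (K : finType) (f : K -> R) : {set K} := [set k | f k != 0].

Lemma sum_if_eq (K : finType) (k0 : K) (S : {set K}) (t : R) :
  \sum_(k in S) (if k == k0 then t else 0) = if k0 \in S then t else 0.
Proof.
have [kS|kS] := boolP (k0 \in S).
  by rewrite (bigD1 k0)//= eqxx big1 ?addr0// => k /andP[_ /negPf ->].
by rewrite big1// => k kS'; case: eqP kS' kS => // -> ->.
Qed.

Lemma sumT_if_eq (K : finType) (k0 : K) (t : R) :
  \sum_k (if k == k0 then t else 0) = t.
Proof. by rewrite (bigD1 k0)//= eqxx big1 ?addr0// => k /negPf ->. Qed.

Lemma nbS A A' : A \subset A' -> nb A \subset nb A'.
Proof.
move=> /fintype.subsetP AA; apply/fintype.subsetP => j;
  rewrite !inE => /existsP[i /andP[iA ij]].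
by apply/existsP; exists i; rewrite AA.
Qed.

Lemma nbU A A' : nb (A :|: A') = nb A :|: nb A'.
Proof.
apply/setP => j; rewrite !inE; apply/existsP/orP.
  by move=> [i]; rewrite inE => /andP[/orP[] iA ij]; [left|right];
    apply/existsP; exists i; rewrite iA.
by move=> [] /existsP[i /andP[iA ij]]; exists i; rewrite inE iA ?orbT.
Qed.

Section push.
Variables (p : I -> R) (q : J -> R) (i0 : I) (j0 : J) (t : R).
Let p' i := p i - (if i == i0 then t else 0).
Let q' j := q j - (if j == j0 then t else 0).
Hypotheses (Eij : E i0 j0) (t0 : 0 <= t).

(** For a set containing [i0], both sides of the Hall inequality lose [t]. Only a set that avoids
    [i0] but has [j0] as a neighbour loses on the right alone, and its slack absorbs this. *)
Lemma hall_push : hall p q ->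
  (forall A, i0 \notin A -> j0 \in nb A ->
    t <= \sum_(j in nb A) q j - \sum_(i in A) p i) -> hall p' q'.
Proof.
move=> pq slack A; rewrite /p' /q' !sumrB !sum_if_eq.
have [iA|iA] := boolP (i0 \in A).
  have -> : j0 \in nb A by rewrite inE; apply/existsP; exists i0; rewrite iA.
  by rewrite lerD2r.
have [jA|jA] := boolP (j0 \in nb A); last by rewrite !subr0.
by rewrite subr0; have := slack A iA jA; lra.
Qed.

Lemma flow_push w : flow p' q' w ->
  flow p q (fun i j => w i j + (if (i == i0) && (j == j0) then t else 0)).
Proof.
move=> [w0 wE wp wq]; split.
- by move=> i j; rewrite addr_ge0//; case: ifP.
- move=> i j nE; rewrite wE// add0r; case: ifP => // /andP[/eqP ii /eqP jj].
  by move: nE; rewrite ii jj Eij.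
- move=> i; rewrite big_split/= wp /p'; have [->|/eqP ii] := eqVneq i i0.
    by rewrite sumT_if_eq subrK.
  by rewrite big1 ?addr0 ?subr0.
- move=> j; rewrite big_split/=; have := wq j; rewrite /q'.
  have [->|/eqP jj] := eqVneq j j0.
    by under [X in _ + X <= _]eq_bigr do rewrite andbT; rewrite sumT_if_eq; lra.
  by rewrite subr0 [X in _ + X]big1 ?addr0// => i _; rewrite andbF.
Qed.

End push.

Section tight.
Variables (p : I -> R) (q : J -> R) (A : {set I}).
Hypotheses (q0 : forall j, 0 <= q j) (pq : hall p q).
Hypothesis tight : \sum_(i in A) p i = \sum_(j in nb A) q j.

(** Hall's condition for [S :&: A], whose neighbours lie in [nb S] and in [nb A]. *)
Lemma hall_in :
  hall (fun i => if i \in A then p i else 0) (fun j => if j \in nb A then q j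
    else 0).
Proof.
move=> S; rewrite -!big_mkcondr/=.
rewrite (eq_bigl (mem (S :&: A))); last by move=> i; rewrite !inE.
apply: le_trans (pq _) _.
rewrite [leRHS](eq_bigl (mem (nb S :&: nb A))); last by move=> i; rewrite !inE.
rewrite (big_setID (nb (S :&: A)) (A := nb S :&: nb A))/=.
rewrite (finset.setIidPr (_ : nb (S :&: A) \subset nb S :&: nb A)).
  by rewrite lerDl sumr_ge0.
by rewrite finset.subsetI !nbS ?subsetIl ?subsetIr.
Qed.

(** Hall's condition for [S :|: A], minus the equality for the tight set [A]. *)
Lemma hall_out :
  hall (fun i => if i \in A then 0 else p i) (fun j => if j \in nb A then 0
    else q j).
Proof.
move=> S.
have -> : \sum_(i in S) (if i \in A then 0 else p i) = \sum_(i in S :\: A) p i.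
  rewrite [RHS]big_mkcond [LHS]big_mkcond/=; apply: eq_bigr => i _.
  by rewrite !inE; case: (i \in A); case: (i \in S).
have -> : \sum_(j in nb S) (if j \in nb A then 0 else q j) = \sum_(j in nb S
  :\: nb A) q j.
  rewrite [RHS]big_mkcond [LHS]big_mkcond/=; apply: eq_bigr => j _.
  by rewrite finset.in_setD; case: (j \in nb A); case: (j \in nb S).
have := pq (S :|: A); rewrite nbU.
rewrite (big_setID A)/= (big_setID (nb A) (A := _ :|: _))/=.
have IU (K : finType) (S1 S2 : {set K}) : (S1 :|: S2) :&: S2 = S2.
  by apply/setP => k; rewrite finset.in_setI finset.in_setU; case: (k \in S2);
    rewrite ?orbT ?andbF.
by rewrite !IU !finset.setDUl !finset.setDv !finset.setU0 tight lerD2l.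
Qed.

End tight.

Lemma flowD p1 p2 q1 q2 w1 w2 : flow p1 q1 w1 -> flow p2 q2 w2 ->
  flow (fun i => p1 i + p2 i) (fun j => q1 j + q2 j) (fun i j => w1 i j + w2 i
    j).
Proof.
move=> [a1 b1 c1 d1] [a2 b2 c2 d2]; split.
- by move=> i j; rewrite addr_ge0.
- by move=> i j nE; rewrite b1// b2// addr0.
- by move=> i; rewrite big_split/= c1 c2.
- by move=> j; rewrite big_split/= lerD.
Qed.

(* Send as much mass as possible along an edge (i0, j0): either the support of
   the marginals decreases, or a set A avoiding i0 becomes tight and the problem
   splits along A. *)
Lemma weighted_hall p q : (forall i, 0 <= p i) -> (forall j, 0 <= q j) ->
  hall p q -> exists w, flow p q w.
Proof.
(* Induction on the total size of the two supports. *)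
have [n] := ubnP (#|supp p| + #|supp q|)%N.
elim: n p q => // n ih p q; rewrite ltnS => card p0 q0 pq.
have [/forallP pz|] := boolP [forall i, p i == 0].
  exists (fun _ _ => 0); split=> //.
    by move=> i; rewrite big1// (eqP (pz i)).
  by move=> j; rewrite big1.
rewrite negb_forall => /existsP[i0 pi0].
have pi0' : 0 < p i0 by rewrite lt_neqAle eq_sym pi0 p0.
have [j0 Eij qj0] : exists2 j0, E i0 j0 & 0 < q j0.
  apply: contrapT => h; have := pq (finset.set1 i0);
    rewrite big_set1 leNgt => /negP; apply.
  apply: le_lt_trans pi0'; rewrite sumr_le0// => j.
  rewrite inE => /existsP[i /andP[]]; rewrite inE => /eqP -> Eij.
  by rewrite leNgt; apply/negP => qj; apply: h; exists j.
pose slack A := \sum_(j in nb A) q j - \sum_(i in A) p i.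
pose C A := (i0 \notin A) && (j0 \in nb A).
pose t0 := Num.min (p i0) (q j0).
have t00 : 0 < t0 by rewrite lt_min pi0' qj0.
have t0p : t0 <= p i0 by rewrite ge_min lexx.
have t0q : t0 <= q j0 by rewrite ge_min lexx orbT.
pose red t i := p i - (if i == i0 then t else 0).
pose red' t j := q j - (if j == j0 then t else 0).
have red0 t : t <= t0 -> forall i, 0 <= red t i.
  by move=> tt i; rewrite /red; case: eqP => [->|_]; rewrite ?subr0// subr_ge0;
    lra.
have red'0 t : t <= t0 -> forall j, 0 <= red' t j.
  by move=> tt j; rewrite /red'; case: eqP => [->|_];
    rewrite ?subr0// subr_ge0; lra.
have sred t : supp (red t) \subset supp p.
  apply/fintype.subsetP => i; rewrite !inE /red; have [->|_] := eqVneq i i0;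
    last by rewrite /= subr0.
  by move=> _.
have sred' t : supp (red' t) \subset supp q.
  apply/fintype.subsetP => j; rewrite !inE /red'; have [->|_] := eqVneq j j0;
    last by rewrite /= subr0.
  by move=> _; exact: lt0r_neq0.
(* If every slack allows it, pushing [t0] empties [i0] or [j0]. *)
have [allC|] := boolP [forall A, C A ==> (t0 <= slack A)].
  have h : hall (red t0) (red' t0).
    by apply: hall_push => // A iA jA; move/forallP/(_ A): allC;
      rewrite /C iA jA.
  have [||||w wf] := ih (red t0) (red' t0); last 1 first.
  - by exists (fun i j => w i j + (if (i == i0) && (j == j0) then t0 else 0));
      apply: flow_push => //; exact: ltW.
  - apply: leq_trans card; have [pq0|pq0] := leP (p i0) (q j0).
      rewrite -addSn leq_add ?subset_leq_card//.
      apply: proper_card; apply/properP; split=> //; exists i0; rewrite !inE//.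
      by rewrite negbK /red eqxx /t0 min_l// subrr.
    rewrite -addnS leq_add ?subset_leq_card//.
    apply: proper_card; apply/properP; split=> //; exists j0;
      rewrite !inE ?(gt_eqF qj0)//.
    by rewrite negbK /red' eqxx /t0 min_r ?subrr// ltW.
  - exact: red0.
  - exact: red'0.
  - exact: h.
rewrite negb_forall => /existsP[A0];
  rewrite negb_imply -ltNge => /andP[CA0 sA0].
(* Otherwise only the minimal slack is pushed, and a set attaining it becomes tight. *)
have [A CA Amin] := @arg_minP _ _ _ A0 C slack CA0.
set t := slack A.
have tt0 : t < t0 by apply: le_lt_trans (Amin _ CA0) sA0.
have t_ge0 : 0 <= t by rewrite subr_ge0; exact: pq.
have h : hall (red t) (red' t).
  by apply: hall_push => // S iS jS; apply: Amin; rewrite /C iS.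
have /andP[iA jA] := CA.
have tight : \sum_(i in A) red t i = \sum_(j in nb A) red' t j.
  by rewrite /red /red' !sumrB !sum_if_eq (negPf iA) jA /t /slack; ring.
(* Both halves of the split have smaller support: the part outside [A] loses [i1], the part inside
   loses [i0]. Such an [i1] exists because [j0] keeps positive mass and [A] is tight. *)
have [i1 i1A pi1] : exists2 i1, i1 \in A & red t i1 != 0.
  apply: contrapT => H; have : 0 < \sum_(j in nb A) red' t j.
    rewrite (bigD1 j0)//= ltr_pwDl ?sumr_ge0// => [|j _]; last by apply: red'0;
      exact: ltW.
    by rewrite /red' eqxx subr_gt0; lra.
  rewrite -tight big1 ?ltxx// => i iA'; apply/eqP; apply: contrapT => /negP ri.
  by apply: H; exists i.
have ri0 : red t i0 != 0 by rewrite /red eqxx subr_eq0 gt_eqF//; lra.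
have sub_in (K : finType) (f : K -> R) (S : {set K}) :
    supp (fun k => if k \in S then f k else 0) \subset supp f.
  by apply/fintype.subsetP => k; rewrite !inE; case: ifP; rewrite ?eqxx.
have sub_out (K : finType) (f : K -> R) (S : {set K}) :
    supp (fun k => if k \in S then 0 else f k) \subset supp f.
  by apply/fintype.subsetP => k; rewrite !inE; case: ifP; rewrite ?eqxx.
have pos_in (K : finType) (f : K -> R) (S : {set K}) : (forall k, 0 <= f k) ->
  forall k, 0 <= if k \in S then f k else 0 by move=> f0 k; case: ifP.
have pos_out (K : finType) (f : K -> R) (S : {set K}) : (forall k, 0 <= f k) ->
  forall k, 0 <= if k \in S then 0 else f k by move=> f0 k; case: ifP.
have r0 := red0 _ (ltW tt0); have r'0 := red'0 _ (ltW tt0).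
have [||||w1 f1] := ih (fun i => if i \in A then red t i else 0)
    (fun j => if j \in nb A then red' t j else 0); last 1 first.
- have [||||w2 f2] := ih (fun i => if i \in A then 0 else red t i)
      (fun j => if j \in nb A then 0 else red' t j); last 1 first.
  + exists (fun i j => w1 i j + w2 i j + (if (i == i0) && (j == j0) then t else
    0)).
    apply: flow_push => //.
    have := flowD f1 f2; congr flow.
      by apply/funext => i; case: ifP; rewrite ?addr0 ?add0r.
    by apply/funext => j; case: ifP; rewrite ?addr0 ?add0r.
  + apply: leq_trans card; rewrite -addSn leq_add//.
      apply: proper_card; apply/properP; split;
        first exact: fintype.subset_trans (sub_out _ _ _) (sred t).
      exists i1; first by apply: (fintype.subsetP (sred t)); rewrite inE.
      by rewrite !inE i1A eqxx.
    apply: subset_leq_card;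
      exact: fintype.subset_trans (sub_out _ _ _) (sred' t).
  + exact: pos_out.
  + exact: pos_out.
  + exact: hall_out.
- apply: leq_trans card; rewrite -addSn leq_add//.
    apply: proper_card; apply/properP; split;
      first exact: fintype.subset_trans (sub_in _ _ _) (sred t).
    by exists i0; rewrite !inE// (negPf iA) eqxx.
  apply: subset_leq_card; exact: fintype.subset_trans (sub_in _ _ _) (sred' t).
- exact: pos_in.
- exact: pos_in.
- exact: hall_in.
Qed.

End weighted_hall.

(* Let the unmatched mass go to an extra vertex [None] of weight [d]. *)
Lemma finite_coupling (R : realFieldType) (I J : finType) (E : I -> J -> bool)
    (p : I -> R) (q : J -> R) (d : R) :
  (forall i, 0 <= p i) -> (forall j, 0 <= q j) -> \sum_i p i = \sum_j q j ->
  (forall A : {set I}, \sum_(i in A) p i <= \sum_(j in nb E A) q j + d) ->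
  exists v : I -> J -> R, [/\ forall i j, 0 <= v i j,
    forall i, \sum_j v i j = p i, forall j, \sum_i v i j = q j
    & \sum_i \sum_(j | ~~ E i j) v i j <= d].
Proof.
move=> p0 q0 pq def.
have d0 : 0 <= d.
  have := def finset.set0;
    rewrite big_set0 (_ : nb E finset.set0 = finset.set0).
    by rewrite big_set0 add0r.
  by apply/setP => j; rewrite !inE; apply/existsP => -[i]; rewrite inE.
pose E' i (o : option J) := if o is Some j then E i j else true.
pose q' (o : option J) := if o is Some j then q j else d.
have sumo (f : option J -> R) : \sum_o f o = f None + \sum_j f (Some j).
  rewrite (bigD1 None)//=; congr (_ + _).
  rewrite (reindex_omap Some id)/=; last by case.
  by apply: eq_bigl => j; rewrite eqxx.
have [|||w [w0 wE wp wq]] := @weighted_hall R I (option J) E' p q' => //.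
- by case.
- move=> A; have [->|/finset.set0Pn[i iA]] := eqVneq A finset.set0.
    by rewrite big_set0; apply: sumr_ge0 => -[j|] _ //=.
  apply: le_trans (def A) _.
  rewrite [leRHS]big_mkcond/= sumo addrC lerD//.
    rewrite (_ : None \in _)// inE; apply/existsP; exists i; by rewrite iA.
  rewrite big_mkcond/=; apply: ler_sum => j _.
  by rewrite !inE.
(* The unmatched masses [r] and [c] have the same total [D] and are coupled by their normalized
   product. Only this part can charge pairs outside [E]. *)
pose r i := w i None; pose c j := q j - \sum_i w i (Some j).
have r0 i : 0 <= r i by exact: w0.
have c0 j : 0 <= c j by rewrite subr_ge0; exact: wq (Some j).
pose D := \sum_i r i.
have Dd : D <= d by exact: wq None.
have D0 : 0 <= D by exact: sumr_ge0.
have rE i : \sum_j w i (Some j) = p i - r i by rewrite -wp sumo [_ + \sum_j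
  _]addrC addrK.
have cD : \sum_j c j = D.
  rewrite sumrB -pq exchange_big/=; under [X in _ - X]eq_bigr do rewrite rE.
  by rewrite sumrB /D; ring.
(* If [D = 0] then all [r i] vanish, so the convention on division by 0 does no harm. *)
have DD i : r i * (D / D) = r i.
  have [Dz|Dz] := eqVneq D 0; last by rewrite divff// mulr1.
  by rewrite Dz mul0r mulr0; apply/esym/eqP; move/eqP: Dz;
    rewrite psumr_eq0// => /allP/(_ i); rewrite mem_index_enum => /(_ isT).
have DDc j : c j * (D / D) = c j.
  have [Dz|Dz] := eqVneq D 0; last by rewrite divff// mulr1.
  by rewrite Dz mul0r mulr0; apply/esym/eqP; move/eqP: Dz;
    rewrite -cD psumr_eq0// => /allP/(_ j); rewrite mem_index_enum => /(_ isT).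
exists (fun i j => w i (Some j) + r i * c j / D); split.
- by move=> i j; rewrite addr_ge0// divr_ge0// mulr_ge0.
- move=> i; rewrite big_split/= rE -mulr_suml -mulr_sumr cD -mulrA DD.
  by rewrite subrK.
- move=> j; rewrite big_split/=.
  under [X in _ + X]eq_bigr do rewrite mulrAC mulrC.
  by rewrite -mulr_sumr -mulr_suml DDc /c addrC subrK.
- apply: le_trans Dd; apply: ler_sum => i _.
  rewrite -[leRHS]DD (eq_bigr (fun j => r i * c j / D)); last first.
    by move=> j nE; rewrite wE// add0r.
  apply: (@le_trans _ _ (\sum_j r i * c j / D)).
    rewrite big_mkcond/=; apply: ler_sum => j _; case: ifP => // _.
    by rewrite divr_ge0// mulr_ge0.
  by rewrite -mulr_suml -mulr_sumr cD mulrA.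
Qed.

(** * Couplings realized on an atomless probability space *)

Section simple_labels.
Context d (T : measurableType d) (R : realType) (P : probability T R).

(** Atomlessness, in the form given by Sierpinski's theorem. *)
Definition splittable := forall (E : set T) (a : R), measurable E ->
  0 <= a -> a <= Pr P E -> exists F, [/\ measurable F, F `<=` E & Pr P F = a].

(** A finite-valued random variable is kept as a measurable label together with an arbitrary list of
    points, so that the preimage of any set of points is measurable. *)
Definition simple (k : T -> nat) (N : nat) :=
  (forall s, (k s < N.+1)%N) /\ (forall j, measurable (k @^-1` [set j])).

Lemma measurable_simple k N (Q : set nat) : simple k N -> measurable (k @^-1`
  Q).
Proof.
move=> [_ mk]; rewrite (_ : k @^-1` Q = \bigcup_(j in Q) (k @^-1` [set j])).
  by apply: bigcup_measurable => j _; exact: mk.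
by apply/seteqP; split=> [s Qs|s [j Qj /= ->]//]; exists (k s).
Qed.

Lemma Pr_simple k N (Q : pred nat) : simple k N ->
  Pr P [set s | Q (k s)] = \sum_(i < N.+1 | Q i) Pr P (k @^-1` [set val i]).
Proof.
move=> [kN mk].
have [|_ <-] := Pr_disjoint_sum P N.+1 Q mk; first by move=> i j s /= <- <-.
congr Pr; apply/seteqP; split=> s /=; first by move=> Qs; exists (k s).
by move=> [i [_ Qi ->]].
Qed.

Hypothesis splitP : splittable.

(** The piece with the last label is cut off and the rest of [E] is split by induction; labels
    outside [E] are arbitrary. *)
Lemma split_set M (E : set T) (v : nat -> R) : measurable E ->
  (forall j, 0 <= v j) -> \sum_(j < M.+1) v j = Pr P E ->
  exists k, simple k M /\ forall j, (j < M.+1)%N -> Pr P (E `&` k @^-1` [set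
    j]) = v j.
Proof.
elim: M E => [|M ih] E mE v0 vE.
  exists (fun=> 0%N); split; first split=> // j.
    by rewrite preimage_cst; case: ifP.
  move=> j; rewrite ltnS leqn0 => /eqP ->.
  rewrite (_ : _ `&` _ = E); first by rewrite -vE big_ord_recl big_ord0 addr0.
  by apply/seteqP; split=> s // [].
rewrite big_ord_recr/= in vE.
have s0 : 0 <= \sum_(j < M.+1) v j by exact: sumr_ge0.
have [|F [mF FE PF]] := splitP mE (v0 M.+1); first by lra.
have mEF : measurable (E `\` F) by exact: measurableD.
have EF : \sum_(j < M.+1) v j = Pr P (E `\` F).
  by have := PrDI P mE mF; rewrite (setIidr FE) PF; lra.
have [k [[kM mk] kv]] := ih _ mEF v0 EF.
exists (fun s => if pselect (F s) then M.+1 else k s); split; first split.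
- by move=> s; case: (pselect (F s)) => Fs //=; exact: ltnW (kM s).
- move=> j.
  rewrite (_ : _ @^-1` _ = (F `&` [set _ | j = M.+1]) `|` (k @^-1` [set j] `\`
    F)).
    apply: measurableU; last exact: measurableD.
    have [->|nj] := eqVneq j M.+1.
      by rewrite (_ : [set _ | _] = setT) ?setIT//; apply/seteqP; split.
    rewrite (_ : [set _ | _] = set0) ?setI0// -subset0 => s /= /eqP.
    by rewrite (negPf nj).
  apply/seteqP; split=> s /=; first by case: pselect => Fs <-; [left|right].
  by move=> [[Fs ->]|[ks Fs]]; case: pselect.
- move=> j; rewrite ltnS leq_eqVlt => /orP[/eqP ->|jM].
    rewrite -PF; congr Pr; apply/seteqP; split=> s /=.
      by move=> [Es]; case: (pselect (F s)) => //= nF kE; have := kM s;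
        rewrite kE ltnn.
    by move=> Fs; split; [exact: FE|case: pselect].
  rewrite -(kv j jM); congr Pr; apply/seteqP; split=> s /=.
    by move=> [Es]; case: (pselect (F s)) => //= Fs jE; move: jM;
      rewrite -jE ltnn.
  by move=> [[Es Fs] kj]; split=> //; case: pselect.
Qed.

Lemma split_labels k N M (v : nat -> nat -> R) : simple k N ->
  (forall i j, 0 <= v i j) ->
  (forall i, (i < N.+1)%N -> \sum_(j < M.+1) v i j = Pr P (k @^-1` [set i])) ->
  exists k', simple k' M /\ forall i j, (i < N.+1)%N -> (j < M.+1)%N ->
    Pr P [set s | k s = i /\ k' s = j] = v i j.
Proof.
move=> ks v0 vk; have [kN mk] := ks.
have /choice[l lP] i : exists l, simple l M /\ ((i < N.+1)%N ->
    forall j, (j < M.+1)%N -> Pr P (k @^-1` [set i] `&` l @^-1` [set j]) = v i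
      j).
  have [iN|iN] := boolP (i < N.+1)%N.
    by have [l [ls lv]] := split_set (mk i) (v0 i) (vk i iN); exists l.
  (* The label [i] never occurs here, but the choice needs some simple [l]. *)
  have [|||l [ls _]] := @split_set M set0 (fun=> 0) => //.
    by rewrite Pr0 big1.
  by exists l.
exists (fun s => l (k s) s); split; first split.
- by move=> s; have [[lM _] _] := lP (k s); exact: lM.
- move=> j; rewrite (_ : _ @^-1` _ = \bigcup_i (k @^-1` [set i] `&` l i @^-1`
  [set j])).
    apply: bigcupT_measurable => i; apply: measurableI => //.
    by have [[_ ml] _] := lP i; exact: ml.
  apply/seteqP; split=> s /=; first by move=> <-; exists (k s).
  by move=> [i _ [/= -> ->]].
- move=> i j iN jM; have [_ /(_ iN j jM) <-] := lP i.
  by congr Pr; apply/seteqP; split=> s /= [->].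
Qed.

Lemma Pr_simple2 k k' N M (Q : nat -> nat -> bool) : simple k N -> simple k' M
  ->
  measurable [set s | Q (k s) (k' s)] /\
  Pr P [set s | Q (k s) (k' s)] = \sum_(i < N.+1) \sum_(j < M.+1 | Q i j)
     Pr P [set s | k s = i /\ k' s = j].
Proof.
move=> ks k's; have [kN mk] := ks; have [k'M mk'] := k's.
pose F i := [set s | k s = i /\ Q i (k' s)].
have mF i : measurable (F i).
  exact: (measurableI _ _ (mk i) (measurable_simple [set j | Q i j] k's)).
have [|m E] := Pr_disjoint_sum P N.+1 xpredT mF;
  first by move=> i j s [<- _] [<- _].
have -> : [set s | Q (k s) (k' s)] = [set s | exists i, [/\ (i < N.+1)%N, true
  & F i s]].
  apply/seteqP; split=> s /=; first by move=> Qs; exists (k s).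
  by move=> [i [_ _ [->]]].
split=> //; rewrite E; apply: eq_bigr => i _.
have [||_ <-] := @Pr_disjoint_sum _ _ _ P M.+1 (Q i) (fun j => [set s | k s = i
  /\ k' s = j]).
- by move=> j; exact: (measurableI _ _ (mk i) (mk' j)).
- by move=> j j' s [_ <-] [_ <-].
congr Pr; apply/seteqP; split=> s /=; first by move=> [ki Qi]; exists (k' s).
by move=> [j [_ Qj [ki kj]]]; rewrite /F/= ki kj.
Qed.

(** The coupling is realized inside the fibres of the given [k], which is left unchanged, so
    couplings can be chained. *)
Lemma couple_labels k N M (q : nat -> R) (E : nat -> nat -> bool) (r : R) :
  simple k N -> (forall j, 0 <= q j) -> \sum_(j < M.+1) q j = 1 ->
  (forall Q : pred nat, Pr P [set s | Q (k s)] <=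
    \sum_(j < M.+1 | [exists i : 'I_N.+1, Q i && E i j]) q j + r) ->
  exists k', [/\ simple k' M, forall j, (j < M.+1)%N -> Pr P (k' @^-1` [set j])
    = q j
    & Pr P [set s | ~~ E (k s) (k' s)] <= r].
Proof.
move=> ks q0 q1 def.
pose p (i : 'I_N.+1) := Pr P (k @^-1` [set val i]).
have p1 : \sum_i p i = 1.
  have := Pr_simple xpredT ks; rewrite (_ : [set _ | _] = setT) ?PrT//.
  by apply/seteqP; split.
have [||||v [v0 vp vq vE]] := @finite_coupling R 'I_N.+1 'I_M.+1 (fun i j => E
  i j) p
    (fun j => q j) r.
- by move=> i; exact: Pr_ge0.
- by move=> j; exact: q0.
- by rewrite p1 q1.
- move=> A; pose Q i := (i < N.+1)%N && (inord i \in A).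
  have := def Q; rewrite (Pr_simple Q ks).
  have QA (i : 'I_N.+1) : Q i = (i \in A) by rewrite /Q ltn_ord inord_val.
  rewrite (eq_bigl (mem A)) => [|i]; last exact: QA.
  move=> h; apply: le_trans h _;
    rewrite lerD2r (eq_bigl (mem (nb (fun (i : 'I_N.+1) (j : 'I_M.+1) => E i j)
    A)))//.
  by move=> j /=; rewrite inE; apply/existsP/existsP => -[i ij]; exists i;
    move: ij; rewrite QA.
pose v' i j := v (inord i) (inord j).
have v'E (i : 'I_N.+1) (j : 'I_M.+1) : v' i j = v i j by rewrite /v' !inord_val.
have [||k' [k's k'v]] := @split_labels k N M v' ks.
- by move=> i j; exact: v0.
- move=> i iN; rewrite -[i]/(val (Ordinal iN)) -/(p (Ordinal iN)) -vp.
  by apply: eq_bigr => j _; rewrite v'E.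
exists k'; split=> //.
- move=> j jM; pose Q (i j' : nat) := j' == j.
  have [_ E2] := Pr_simple2 Q ks k's.
  rewrite (_ : k' @^-1` _ = [set s | Q (k s) (k' s)]); last first.
    by apply/seteqP; split=> s /= /eqP.
  rewrite E2 -[j]/(val (Ordinal jM)) -vq; apply: eq_bigr => i _.
  rewrite (bigD1 (Ordinal jM))/= ?/Q// big1 ?addr0 => [|j' /andP[/eqP jj
    /eqP[]]].
    by rewrite k'v// -v'E.
  by apply: val_inj.
- apply: le_trans vE; have [_ ->] := Pr_simple2 (fun i j => ~~ E i j) ks k's.
  apply: ler_sum => i _; apply: ler_sum => j _.
  by rewrite k'v// v'E.
Qed.

End simple_labels.

Section coupling_step.
Context {R : realType} {B : metricType R}.
Context d (T : measurableType d) (P : probability T R).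

(** A one-sided Prokhorov bound between the law of the labelled points and the measure of [X]. *)
Definition fits (X : mmField B) (k : T -> nat) (x : nat -> X) (e : R) :=
  forall A : set X, Pr P [set s | A (x (k s))] <= mass (thickening A e) + e.

Lemma coupling_step (X Y : mmField B) (delta : X -> Y -> R) (e e' : R)
    (k : T -> nat) (N : nat) (x : nat -> X) :
  splittable P -> cross_metric delta -> transports delta e -> 0 < e' -> e' <= e
    ->
  simple k N -> fits k x e ->
  exists (k' : T -> nat) (M : nat) (y : nat -> Y), [/\ simple k' M, fits k' y e'
    & Pr P [set s | ~~ (delta (x (k s)) (y (k' s)) < e *+ 3)] <= e *+ 3].
Proof.
move=> splitP dP dt e'0 e'e ks kx.
have [v vd] := separable_dense_sequence (bf_polish Y).
have [M vM] := ball_union_mass vd e'0 e'0.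
set K := ball_union v e' M in vM.
have mK : measurable (K : set (borel Y)) by apply: measurable_open;
  exact: open_ball_union.
(* The extra label [M] collects the mass outside the cells and is placed at [v M]. *)
pose q j := if (j < M)%N then mass (cell v e' j) else 1 - mass K.
have q0 j : 0 <= q j.
  rewrite /q; case: ifP => _; first exact: Pr_ge0.
  by rewrite subr_ge0 Pr_le1.
have cells (Q : pred nat) := Pr_disjoint_sum (@mm_measure R B Y) M Q
  (measurable_cell v e') (@cell_disjoint _ _ _ v e').
have sumq (Q : pred nat) : \sum_(j < M.+1 | Q j) q j =
    \sum_(j < M | Q j) mass (cell v e' j) + (if Q M then 1 - mass K else 0).
  rewrite big_mkcond big_ord_recr/= -big_mkcond/= /q ltnn; congr (_ + _).
  by apply: eq_bigr => j _; rewrite ltn_ord.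
have q1 : \sum_(j < M.+1) q j = 1.
  have := sumq xpredT; rewrite /= => ->.
  have [_ <-] := cells xpredT.
  rewrite (_ : [set _ | _] = K); first by rewrite /mass addrC subrK.
  apply/seteqP; split=> y /=; first by move=> [i [iM _ [yi _]]]; exists i.
  by move=> /ball_union_cell[i iM yi]; exists i.
pose E i j := delta (x i) (v j) < e *+ 3.
(* Each of [fits], [transports] and the discretization of [Y] costs at most [e], in distance and in
   mass. *)
have [|k' [k's k'q k'E]] := @couple_labels _ _ _ P splitP k N M q E (e *+ 3) ks
  q0 q1.
  move=> Q; pose A := [set a | exists2 i, Q i && (i < N.+1)%N & a = x i].
  pose W := thick delta (thickening A e) e.
  have mW : measurable (W : set (borel Y)) by exact: measurable_thick.
  have h1 : Pr P [set s | Q (k s)] <= Pr P [set s | A (x (k s))].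
    apply: le_Pr; [exact: (measurable_simple Q ks)|
      exact: (measurable_simple (fun i => A (x i)) ks)|].
    by move=> s Qs; exists (k s) => //; have [kN _] := ks; rewrite kN andbT.
  have h2 := kx A.
  have h3 := dt (thickening A e) (measurable_open (@open_thickening R X A e)).
  have h4 := Pr_setI_ge (@mm_measure R B Y) mW mK.
  pose Q' j := [exists i : 'I_N.+1, Q i && E i j].
  have [mC EC] := cells Q'.
  have h5 : Pr (@mm_measure R B Y) (W `&` K) <= \sum_(j < M | Q' j) mass (cell
    v e' j).
    rewrite -EC; apply: le_Pr => //; first exact: measurableI.
    move=> y [[x' [_ [i /andP[Qi iN] ->] xx'] x'y] /ball_union_cell[j jM yj]].
    exists j; split=> //; apply/existsP; exists (Ordinal iN); rewrite Qi/= /E.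
    case: dP => _ d2 d3 _ _; move: yj => [yj _].
    by move: (d2 (x i) x' (v j)) (d3 x' (v j) y); lra.
  have h6 : \sum_(j < M | Q' j) mass (cell v e' j) <= \sum_(j < M.+1 | Q' j) q
    j.
    by rewrite sumq lerDl; case: ifP => // _; rewrite subr_ge0 Pr_le1.
  apply: le_trans (lerD h6 (lexx _)); move: h1 h2 h3 h4 h5 vM;
    rewrite /mass -/W; lra.
exists k', M, v; split=> // A.
pose Q j := `[< A (v j) >].
have -> : [set s | A (v (k' s))] = [set s | Q (k' s)].
  by apply/seteqP; split=> s /= /asboolP.
rewrite (Pr_simple P Q k's) (eq_bigr (fun j : 'I_M.+1 => q j)) => [|j _];
  last first.
  by apply: k'q; exact: ltn_ord.
have [mC EC] := cells Q; rewrite sumq -EC lerD//.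
  apply: le_Pr => //; first by apply: measurable_open;
    exact: (@open_thickening R Y).
  move=> y [j [jM /asboolP Aj [yj _]]]; exists (v j) => //.
  by rewrite metric_sym.
by case: ifP => _; [move: vM; lra|exact: ltW].
Qed.

End coupling_step.

(** * The uniform law on the unit interval has no atoms *)

Section uniform_splittable.
Context (R : realType).
Let mu := @lebesgue_measure R.
Let P : probability _ R := @uniform_prob R 0 1 ltr01.

Lemma uniform_prob_le (A : set R) : measurable A -> (P A <= mu (A `&` `[0%R,
  1%R]))%E.
Proof.
move=> mA; rewrite /P/= /uniform_prob integral_uniform_pdf.
apply: (@le_trans _ _ (\int[mu]_(x in A `&` `[0%R, 1%R]%classic) (1%:E)))%E;
  last first.
  by rewrite integral_cst//= ?mul1e//; exact: measurableI.
apply: ge0_le_integral => //=.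
- exact: measurableI.
- by move=> x _; rewrite lee_fin uniform_pdf_ge0.
- by apply/measurable_realfun.measurable_EFinP/measurable_funTS;
  exact: measurable_uniform_pdf.
- by move=> x [_]; rewrite /= in_itv/= /uniform_pdf => ->; rewrite subr0 invr1.
Qed.

(** The mass of the part of [E] below [t] is 1-Lipschitz in [t] and grows from 0 to the mass of [E]
    on [0, 1], so it takes the value [a]. *)
Lemma uniform_prob_splittable : splittable P.
Proof.
move=> E a mE a0 aE.
have mI (t : R) : measurable `]-oo, t] by [].
have mEI t : measurable (E `&` `]-oo, t]) by exact: measurableI.
pose g t := Pr P (E `&` `]-oo, t]).
have gmono s t : s <= t -> g s <= g t.
  move=> st; apply: le_Pr => // x [Ex /=]; rewrite !in_itv/= => xs; split=> //=.
  exact: le_trans xs st.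
have gL s t : s <= t -> g t <= g s + (t - s).
  move=> st.
  have h1 := PrDI P (mEI t) (mI s).
  have h2 : Pr P (E `&` `]-oo, t] `&` `]-oo, s]) <= g s.
    apply: le_Pr => //; first exact: measurableI.
    by move=> x [[]].
  have h3 : Pr P ((E `&` `]-oo, t]) `\` `]-oo, s]) <= t - s.
    have mD : measurable ((E `&` `]-oo, t]) `\` `]-oo, s]) by exact:
      measurableD.
    rewrite -lee_fin -PrE//; apply: le_trans (uniform_prob_le mD) _.
    apply: (@le_trans _ _ (mu `]s, t])).
      apply: le_measure; rewrite ?inE//; first exact: measurableI.
      move=> x [[[_ /=]]]; rewrite !in_itv/= => xt /negP;
        rewrite -ltNge => sx _.
      by rewrite sx xt.
    rewrite /mu lebesgue_measure_itv/= lte_fin; case: ifP => // _.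
    by rewrite lee_fin subr_ge0.
  by rewrite (h1 : g t = _) addrC; exact: lerD.
have gc : continuous g.
  move=> t; apply/cvgrPdist_lt => e e0; near=> s.
  have ts : `|t - s| < e by near: s; apply: cvgr_dist_lt.
  rewrite ltr_norml in ts; case/andP: ts => ts1 ts2.
  rewrite ltr_norml; apply/andP; have [st|/ltW st] := leP s t.
    by move: (gmono _ _ st) (gL _ _ st); split; lra.
  by move: (gmono _ _ st) (gL _ _ st); split; lra.
have g0 : g 0 = 0.
  apply/eqP; rewrite eq_le Pr_ge0 andbT -lee_fin -PrE//.
  apply: le_trans (uniform_prob_le (mEI 0)) _.
  apply: (@le_trans _ _ (mu [set 0]));
    last by rewrite /mu lebesgue_measure_set1.
  apply: le_measure; rewrite ?inE//; first exact: measurableI.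
  move=> x [[_ /=]]; rewrite !in_itv/= => x0 /andP[x0' _].
  by apply/eqP; rewrite eq_le x0.
have g1 : g 1 = Pr P E.
  have h := PrDI P mE (mI 1); rewrite h -/(g 1) -[LHS]add0r; congr (_ + _).
  apply/esym/eqP; rewrite eq_le Pr_ge0 andbT -lee_fin -PrE//;
    last exact: measurableD.
  apply: le_trans (uniform_prob_le _) _; first exact: measurableD.
  rewrite [X in mu X](_ : _ = set0); first by rewrite /mu measure0.
  rewrite -subset0 => x [[_ /=]].
  by rewrite !in_itv/= => /negP; rewrite -ltNge ltNge => /negP h' /andP[_ /h'].
have [||t _ gt] := @IVT R g 0 1 a ler01.
- by apply: continuous_subspaceT.
- by rewrite g0 g1 min_l ?max_r ?a0 ?aE// Pr_ge0.
by exists (E `&` `]-oo, t]); split=> // x [].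
Unshelve. all: by end_near. Qed.

End uniform_splittable.

(** * Completion of a pseudometric *)

Lemma real_cauchy_limit (R : realType) (u : nat -> R) :
  (forall e : R, 0 < e -> exists N, forall m n, (N <= m)%N -> (N <= n)%N ->
    `|u m - u n| < e) ->
  exists l, forall e : R, 0 < e -> exists N, forall n, (N <= n)%N -> `|u n - l|
    < e.
Proof.
move=> uC.
have /cauchy_cvgP/cvgrPdist_lt h : cauchy (u @ \oo).
  apply: cauchy_exP => e e0; have [N Ne] := uC e e0; exists (u N).
  by exists N => // n Nn; rewrite /ball/=; exact: Ne.
exists (lim (u @ \oo)) => e e0; have [N _ Ne] := h e e0.
by exists N => n Nn; rewrite distrC; exact: Ne.
Qed.

Lemma separable_of_sequence (R : realType) (T : Type) (d : T -> T -> R) (u :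
  nat -> T) :
  (forall x (e : R), 0 < e -> exists k, d x (u k) < e) -> separable_distance d.
Proof.
move=> ud; exists (fun x => exists k, x = u k).
  pose f x := if pselect (exists k, x = u k) is left h then sval (cid h) else
    0%N.
  exists f => x y hx hy; rewrite /f.
  case: pselect => // hx'; case: pselect => // hy'.
  by case: (cid hx') => p /= ->; case: (cid hy') => q /= -> ->.
by move=> x e /(ud x)[k xk]; exists (u k) => //; exists k.
Qed.

Section completion.
Context (R : realType) (S : Type) (s0 : S) (rho : S -> S -> R).
Hypotheses (rho0 : forall s, rho s s = 0) (rhoC : forall s t, rho s t = rho t s)
  (rho_tri : forall s t r, rho s r <= rho s t + rho t r).

(* A point of the completion is encoded by its distances to the points of S. *)
Definition is_distance_to (f : S -> R) : Prop :=
  [/\ forall s t, f t <= f s + rho s t, forall s t, rho s t <= f s + f t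
    & forall e : R, 0 < e -> exists s, f s < e].

Definition completion := {f : S -> R | is_distance_to f}.

Implicit Types f g h : completion.

Lemma rho_is_distance_to s : is_distance_to (rho s).
Proof.
split=> [t r|t r|e e0]; first exact: rho_tri.
  by rewrite (rhoC s t); exact: rho_tri.
by exists s; rewrite rho0.
Qed.

(** Points of [S] at distance 0 give the same function, so no quotient has to be taken. *)
Definition completion_of s : completion := exist _ _ (rho_is_distance_to s).

Lemma completion_ge0 f s : 0 <= sval f s.
Proof. by case: f => f [_ + _] /=; move=> /(_ s s); rewrite rho0; lra. Qed.

(** The length of the shortest path through a point of [S]; it is the distance because [S] is dense
    in its completion. *)
Definition completion_dist f g := inf (range (fun s => sval f s + sval g s)).

Lemma completion_dist_le f g s : completion_dist f g <= sval f s + sval g s.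
Proof. by apply: inf_family_le => t; rewrite addr_ge0// completion_ge0. Qed.

Lemma le_completion_dist f g (a : R) :
  (forall s, a <= sval f s + sval g s) -> a <= completion_dist f g.
Proof. exact: (le_inf_family s0). Qed.

Lemma completion_dist_sub f g s : sval f s - sval g s <= completion_dist f g.
Proof.
apply: le_completion_dist => t.
case: f g => f [/= f1 _ _] [g [/= _ g2 _]].
by move: (f1 t s) (g2 t s); lra.
Qed.

Lemma completion_distC f g : completion_dist f g = completion_dist g f.
Proof.
rewrite /completion_dist (_ : (fun s => sval f s + sval g s) = (fun s => sval g
  s + sval f s))//.
by apply/funext => s; exact: addrC.
Qed.

Lemma is_metric_completion : is_metric completion_dist.
Proof.
split.
- by move=> f g; apply: le_completion_dist => s;
  rewrite addr_ge0// completion_ge0.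
- move=> f g; split=> [fg0|<-].
    suff E : sval f = sval g.
      by case: f g E {fg0} => f fP [g gP] /= E; exact: eq_exist.
    apply/funext => s; apply/eqP; rewrite eq_le.
    have := completion_dist_sub f g s; have := completion_dist_sub g f s.
    by rewrite completion_distC fg0; move=> *; apply/andP; split; lra.
  apply/eqP; rewrite eq_le le_completion_dist ?andbT; last first.
    by move=> s; rewrite addr_ge0// completion_ge0.
  apply/ler_addgt0Pr => e e0; have [_ _ /(_ (e / 2))[|s se]] := svalP f;
    first lra.
  by move: (completion_dist_le f f s); lra.
- exact: completion_distC.
- move=> f g h; rewrite -lerBlDl; apply: le_completion_dist => t.
  rewrite lerBlDl -lerBlDr; apply: le_completion_dist => s.
  have [f1 _ _] := svalP f; have [_ g2 _] := svalP g.
  by move: (completion_dist_le f h t) (f1 s t) (g2 s t); lra.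
Qed.

Lemma completion_dist_of s f : completion_dist (completion_of s) f = sval f s.
Proof.
apply/eqP; rewrite eq_le; apply/andP; split.
  by have := completion_dist_le (completion_of s) f s; rewrite /= rho0 add0r.
apply: le_completion_dist => t /=; have [f1 _ _] := svalP f.
by move: (f1 t s); rewrite rhoC; lra.
Qed.

(** A Cauchy sequence converges uniformly as functions on [S], and uniform limits still have
    arbitrarily small values. *)
Lemma completion_complete : complete_distance completion_dist.
Proof.
move=> F FC.
have /choice[l lP] s : exists l, forall e : R, 0 < e -> exists N, forall n,
    (N <= n)%N -> `|sval (F n) s - l| < e.
  apply: real_cauchy_limit => e /FC[N Ne]; exists N => m n Nm Nn.
  have := Ne _ _ Nm Nn; move: (completion_dist_sub (F m) (F n) s).
  move: (completion_dist_sub (F n) (F m) s);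
    rewrite completion_distC => h1 h2 h3.
  by rewrite ltr_norml; apply/andP; split; lra.
have Fl (e : R) : 0 < e -> exists N, forall n s, (N <= n)%N -> `|sval (F n) s -
  l s| <= e.
  move=> /FC[N Ne]; exists N => n s Nn; apply/ler_addgt0Pr => e' /(lP s)[M Me].
  have := Me _ (leq_maxr N M); have := Ne _ _ Nn (leq_maxl N M).
  move: (completion_dist_sub (F n) (F (maxn N M)) s).
  move: (completion_dist_sub (F (maxn N M)) (F n) s);
    rewrite completion_distC => h1 h2 h3.
  by rewrite ltr_norml ler_norml => /andP[h4 h5]; apply/andP; split; lra.
have ldist : is_distance_to l.
  split=> [s t|s t|e e0].
  - apply/ler_addgt0Pr => e e0; have [|N Ne] := Fl (e / 2); first lra.
    have := Ne _ s (leqnn N); have := Ne _ t (leqnn N).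
    rewrite !ler_norml => /andP[? ?] /andP[? ?].
    by have [/(_ s t) + _ _] := svalP (F N); lra.
  - apply/ler_addgt0Pr => e e0; have [|N Ne] := Fl (e / 2); first lra.
    have := Ne _ s (leqnn N); have := Ne _ t (leqnn N).
    rewrite !ler_norml => /andP[? ?] /andP[? ?].
    by have [_ /(_ s t) + _] := svalP (F N); lra.
  - have [|N Ne] := Fl (e / 2); first lra.
    have [_ _ /(_ (e / 2))[|s se]] := svalP (F N); first lra.
    by exists s; have := Ne _ s (leqnn N); rewrite ler_norml => /andP[? ?]; lra.
exists (exist _ l ldist) => e e0; have [|N Ne] := Fl (e / 4); first lra.
exists N => n Nn; have [_ _ /(_ (e / 4))[|s se]] := svalP (F n); first lra.
have := completion_dist_le (F n) (exist _ l ldist) s.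
by have := Ne _ s Nn; rewrite ler_norml => /andP[? ?] /=; lra.
Qed.

Lemma completion_dense f (e : R) : 0 < e -> exists s, completion_dist f
  (completion_of s) < e.
Proof.
move=> e0; have [_ _ /(_ e e0)[s se]] := svalP f.
by exists s; rewrite completion_distC completion_dist_of.
Qed.

Lemma completion_separable (u : nat -> S) :
  (forall s (e : R), 0 < e -> exists k, rho s (u k) < e) ->
  separable_distance completion_dist.
Proof.
move=> ud; apply: (@separable_of_sequence _ _ _ (completion_of \o u)) => f e e0.
have [|s fs] := @completion_dense f (e / 2); first lra.
have [|k sk] := ud s (e / 2); first lra.
exists k => /=; have [_ _ _ tri] := is_metric_completion.
have := tri f (completion_of s) (completion_of (u k)).
by rewrite (completion_dist_of s) /= rhoC in sk *; lra.
Qed.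

(** The image of [f] is characterized by being within [sval f s] of [beta s] for every [s], and both
    claims follow from this alone. *)
Lemma completion_extension (B : metricType R) (beta : S -> B) :
  complete_distance (@mdist R B) ->
  (forall s t, mdist (beta s) (beta t) <= rho s t) ->
  exists b : completion -> B, (forall s, b (completion_of s) = beta s) /\
    forall f g, mdist (b f) (b g) <= completion_dist f g.
Proof.
move=> Bc bL.
have /choice[b bP] f : exists b, forall s, mdist (beta s) b <= sval f s.
  have [_ f2 f3] := svalP f.
  have /choice[u uP] n : exists s, sval f s < invS R n by exact: f3 (invS_gt0 R
    n).
  have usmall (e : R) : 0 < e -> exists N, forall n, (N <= n)%N -> sval f (u n)
    < e.
    by move=> /invS_lt[N Ne]; exists N => n /Ne; apply: lt_trans.
  have [l ul] : exists l, converges_to (@mdist R B) (beta \o u) l.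
    apply: Bc => e e0; have [|N Ne] := usmall (e / 2); first lra.
    exists N => m n /Ne um /Ne un /=.
    by move: (bL (u m) (u n)) (f2 (u m) (u n)); lra.
  exists l => s; apply/ler_addgt0Pr => e e0.
  have [|N Ne] := usmall (e / 2); first lra.
  have [|M Me] := ul (e / 2); first lra.
  have := Ne _ (leq_maxl N M); have /= := Me _ (leq_maxr N M).
  move: (bL s (u (maxn N M))) (f2 s (u (maxn N M))).
  by move: (metric_triangle (beta s) (beta (u (maxn N M))) l); lra.
exists b; split=> [s|f g].
  apply/esym/mdist_positivity/eqP; rewrite eq_le mdist_ge0 andbT.
  by have := bP (completion_of s) s; rewrite /= rho0.
apply: le_completion_dist => s; move: (metric_triangle (b f) (beta s) (b g)).
by move: (bP f s) (bP g s) (metric_sym (b f) (beta s)); lra.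
Qed.

Lemma completion_field (B : metricType R) (beta : S -> B) (u : nat -> S) :
  complete_distance (@mdist R B) ->
  (forall s t, mdist (beta s) (beta t) <= rho s t) ->
  (forall s (e : R), 0 < e -> exists k, rho s (u k) < e) ->
  exists (Y : bField B) (i : S -> Y), [/\ forall s t, mdist (i s) (i t) = rho s
    t,
    forall y (e : R), 0 < e -> exists s, mdist y (i s) < e
    & forall s, bf_proj (i s) = beta s].
Proof.
move=> Bc bL ud; have [b [b1 b2]] := completion_extension Bc bL.
pose M : pmetricType R := metric_on is_metric_completion (completion_of s0).
have Mpol : is_polish_metric (@mdist R M).
  split; [exact: is_metric_completion|exact: completion_complete|].
  exact: completion_separable ud.
exists (@BField R B M Mpol b b2), completion_of; split=> //.
  by move=> s t; rewrite rhoC; exact: (completion_dist_of s (completion_of t)).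
exact: completion_dense.
Qed.

End completion.

(** * Completeness *)

Section halves.
Context (R : realType).

Definition half_pow (n : nat) : R := 2^-1 ^+ n.

Lemma half_powS n : half_pow n.+1 = half_pow n / 2.
Proof. by rewrite /half_pow exprSr. Qed.

Lemma half_pow_gt0 n : 0 < half_pow n.
Proof. by rewrite exprn_gt0// invr_gt0. Qed.

Lemma le_half_pow n m : (n <= m)%N -> half_pow m <= half_pow n.
Proof.
by move=> nm; apply: ler_wiXn2l => //; rewrite ?invr_ge0// invf_le1// ler1n.
Qed.

Lemma half_pow_lt (e : R) : 0 < e -> exists N, forall n, (N <= n)%N -> half_pow
  n < e.
Proof.
move=> /invS_lt[N Ne]; exists N => n /Ne; apply: le_lt_trans.
rewrite /half_pow /invS exprVn lef_pV2 ?posrE ?exprn_gt0// -natrX ler_nat.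
by rewrite ltn_expl.
Qed.

Lemma sum_half_pow n m : \sum_(i < m) half_pow (n + i) <= half_pow n *+ 2.
Proof.
suff -> : \sum_(i < m) half_pow (n + i) = half_pow n *+ 2 - half_pow (n + m) *+
  2.
  by rewrite lerBlDr lerDl mulrn_wge0// ltW// half_pow_gt0.
elim: m => [|m ih]; first by rewrite big_ord0 addn0 subrr.
by rewrite big_ord_recr/= ih addnS half_powS; lra.
Qed.

(* The steps 6 2^-m = 12 (2^-m - 2^-(m+1)) telescope. *)
Lemma half_pow_telescope (u : nat -> R) (c : R) n : 0 <= c ->
  (forall m, (n <= m)%N -> `|u m - u m.+1| <= c * half_pow m) ->
  forall m, (n <= m)%N -> `|u n - u m| <= c * (half_pow n - half_pow m) *+ 2.
Proof.
move=> c0 h m /subnK <-; elim: (m - n)%N => [|p ih].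
  by rewrite add0n !subrr normr0 mulr0 mul0rn.
rewrite addSn (le_trans (ler_distD (u (p + n)%N) _ _))//.
have := h (p + n)%N (leq_addl _ _); rewrite half_powS.
by move: ih; lra.
Qed.

Lemma half_pow_limit (u : nat -> R) (c : R) n : 0 <= c ->
  (forall m, (n <= m)%N -> `|u m - u m.+1| <= c * half_pow m) ->
  exists l, forall m, (n <= m)%N -> `|u m - l| <= c * half_pow m *+ 2.
Proof.
move=> c0 h.
have tel m p : (n <= m)%N -> (m <= p)%N -> `|u m - u p| <= c * half_pow m *+ 2.
  move=> nm mp; apply: le_trans (half_pow_telescope c0 _ mp) _.
    by move=> q mq; apply: h; exact: leq_trans mq.
  by rewrite lerMn2r/= ler_wpM2l// gerBl ltW// half_pow_gt0.
have [|l lP] := @real_cauchy_limit R u.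
  move=> e e0; have [|N Ne] := @half_pow_lt (e / (c * 4 + 1)).
    by rewrite divr_gt0//; lra.
  exists (maxn n N) => p q; rewrite !geq_max => /andP[np Np] /andP[nq Nq].
  have := tel _ _ (leq_maxl n N) (_ : maxn n N <= p)%N;
    rewrite geq_max np Np => /(_ isT).
  have := tel _ _ (leq_maxl n N) (_ : maxn n N <= q)%N;
    rewrite geq_max nq Nq => /(_ isT).
  have := Ne _ (leq_maxr n N); rewrite ltr_pdivlMr ?mulrDr; last lra.
  have := half_pow_gt0 (maxn n N); move: (half_pow _) => t t0 te.
  rewrite !ler_norml ltr_norml => /andP[? ?] /andP[? ?]; apply/andP; split; lra.
exists l => m nm; apply/ler_addgt0Pr => e /lP[N Ne].
have := tel m (maxn m N) nm (leq_maxl _ _); have := Ne _ (leq_maxr m N).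
rewrite ltr_norml !ler_norml => /andP[? ?] /andP[? ?]; apply/andP; split; lra.
Qed.

End halves.

Lemma dependent_choice_nat (St : nat -> Type) (r : forall n, St n -> St n.+1 ->
  Prop)
    (s0 : St 0%N) : (forall n s, exists s', r n s s') ->
  exists f : forall n, St n, forall n, r n (f n) (f n.+1).
Proof.
move=> h; pose f := nat_rect St s0 (fun n s => sval (cid (h n s))).
by exists f => n /=; exact: (svalP (cid (h n (f n)))).
Qed.

(** * The limit of a sequence of coupled random variables *)

Section limit.
Context {R : realType} {B : metricType R} (Bc : complete_distance (@mdist R B)).
Context d (T : measurableType d) (P : probability T R).
Variables (X : nat -> mmField B) (delta : forall n, X n -> X n.+1 -> R).
Variables (k : nat -> T -> nat) (N : nat -> nat) (x : forall n, nat -> X n).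
Hypotheses (dP : forall n, cross_metric (@delta n))
  (ks : forall n, simple (k n) (N n))
  (kfit : forall n, fits P (k n) (@x n) (half_pow R n))
  (step : forall n, Pr P [set s | ~~ (@delta n (x n (k n s)) (x n.+1 (k n.+1
    s)) <
     half_pow R n *+ 3)] <= half_pow R n *+ 3).

Local Notation hp := (half_pow R).
Let hp0 n : 0 < hp n := half_pow_gt0 R n.

Let f n s : X n := x n (k n s).

Let bad n := [set s | ~~ (@delta n (f n s) (f n.+1 s) < hp n *+ 3)].

(** From index [n] on, the path of [s] makes only small steps. *)
Let good n := [set s | forall m, (n <= m)%N -> ~ bad m s].

Let mbad n : measurable (bad n).
Proof.
have [] := @Pr_simple2 _ _ _ P (k n) (k n.+1) (N n) (N n.+1)
  (fun i j => ~~ (@delta n (x n i) (x n.+1 j) < hp n *+ 3)) => //.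
Qed.

Let good_mono n m : (n <= m)%N -> good n `<=` good m.
Proof. by move=> nm s gs p mp; apply: gs; exact: leq_trans mp. Qed.

Let goodC n : ~` good n = \bigcup_i bad (n + i)%N.
Proof.
apply/seteqP; split=> s /=.
  move=> ngs; apply: contrapT => h; apply: ngs => m nm bm.
  by apply: h; exists (m - n)%N => //; rewrite subnKC.
by move=> [i _ bs] gs; exact: gs (leq_addr _ _) bs.
Qed.

Let mgood n : measurable (good n).
Proof. by rewrite -[good n]setCK goodC; apply: measurableC;
  exact: bigcupT_measurable. Qed.

Let Pgood n : 1 - hp n *+ 6 <= Pr P (good n).
Proof.
rewrite -[good n]setCK PrC ?lerD2l ?lerN2; last exact: measurableC.
rewrite goodC; apply: (@Pr_bigcup_le_sum _ _ _ P _ (fun i => hp (n + i) *+ 3))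
  => //.
  by move=> i; exact: step.
move=> m; rewrite sumrMnl; have := sum_half_pow R n m; lra.
Qed.

Let D n s t := mdist (f n s) (f n t).

Let D_step n s t m : (n <= m)%N -> good n s -> good n t ->
  `|D m s t - D m.+1 s t| <= 6 * hp m.
Proof.
move=> nm /(_ m nm) /negP; rewrite negbK => hs /(_ m nm) /negP;
  rewrite negbK => ht.
case: (dP m) => _ d2 d3 d4 d5.
move: (d4 (f m s) (f m t) (f m.+1 s)) (d3 (f m t) (f m.+1 s) (f m.+1 t)).
move: (d5 (f m s) (f m.+1 s) (f m.+1 t)) (d2 (f m s) (f m t) (f m.+1 t)).
rewrite ler_norml /D => h1 h2 h3 h4.
have := metric_sym (f m.+1 s) (f m.+1 t); move=> h5; apply/andP; split; lra.
Qed.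

(** The steps are at most 6 2^-m and their tail doubles this. One limit must serve every admissible
    [n], so the estimate starts at the least one. *)
Let rho_ex s t : exists l, forall n, good n s -> good n t -> `|D n s t - l| <=
  12 * hp n.
Proof.
have [[n gs]|h] := pselect (exists n, good n s /\ good n t); last first.
  by exists 0 => n gs gt; exfalso; apply: h; exists n.
pose n0 := ex_minn (ex_intro (fun n => `[< good n s /\ good n t >]) n (asboolT
  gs)).
have [||l lP] := @half_pow_limit R (fun n => D n s t) 6 n0.
- by [].
- move=> m; rewrite /n0; case: ex_minnP => p /asboolP[ps pt] _ pm;
  exact: D_step pm ps pt.
exists l => m ms mt; suff /lP h : (n0 <= m)%N by lra.
by rewrite /n0; case: ex_minnP => p _; apply; exact/asboolP.
Qed.

Let rho s t := sval (cid (rho_ex s t)).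

Let rhoE n s t : good n s -> good n t -> `|D n s t - rho s t| <= 12 * hp n.
Proof. exact: (svalP (cid (rho_ex s t))). Qed.

Let G := \bigcup_n good n.

Let mG : measurable G. Proof. exact: bigcupT_measurable. Qed.

Let good_large s (e : R) n : G s -> 0 < e -> exists m, [/\ (n <= m)%N, good m s
  & hp m < e].
Proof.
move=> [p _ gs] /half_pow_lt[q qe]; exists (maxn n (maxn p q)).
by rewrite leq_maxl; split=> //; [apply: good_mono gs|apply: qe];
  rewrite !leq_max leqnn ?orbT.
Qed.

Let PG : Pr P G = 1.
Proof.
apply/eqP; rewrite eq_le Pr_le1//=; apply/ler_addgt0Pr => e e0.
have [|m me] := @half_pow_lt R (e / 6); first lra.
have := me m (leqnn m); have := Pgood m.
have : Pr P (good m) <= Pr P G by apply: le_Pr => // s gs; exists m.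
lra.
Qed.

Let rho0 s : G s -> rho s s = 0.
Proof.
move=> Gs; have h (e : R) : 0 < e -> `|rho s s| <= e.
  move=> e0; have [|m [_ gs me]] := @good_large s (e / 12) 0%N Gs; first lra.
  by have := rhoE gs gs; rewrite /D mdistxx sub0r normrN; lra.
apply/eqP; rewrite -normr_eq0 eq_le normr_ge0 andbT.
by apply/ler_addgt0Pr => e e0; rewrite add0r; exact: h.
Qed.

Let good3 s t r (e : R) : G s -> G t -> G r -> 0 < e ->
  exists m, [/\ good m s, good m t, good m r & hp m < e].
Proof.
move=> Gs Gt Gr e0; have [m [_ ms _]] := good_large 0 Gs e0.
have [p [mp pt _]] := good_large m Gt e0;
  have [q [pq qr qe]] := good_large p Gr e0.
exists q; split=> //; first exact: good_mono (leq_trans mp pq) _ ms.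
exact: good_mono pq _ pt.
Qed.

Let rhoC s t : G s -> G t -> rho s t = rho t s.
Proof.
move=> Gs Gt; apply/eqP; rewrite eq_le; apply/andP; split;
  apply/ler_addgt0Pr => e e0;
  (have [|m [ms mt _ me]] := @good3 s t t (e / 24) Gs Gt Gt; first lra);
  have := rhoE ms mt; have := rhoE mt ms; rewrite /D metric_sym !ler_norml;
  move=> /andP[? ?] /andP[? ?]; lra.
Qed.

Let rho_tri s t r : G s -> G t -> G r -> rho s r <= rho s t + rho t r.
Proof.
move=> Gs Gt Gr; apply/ler_addgt0Pr => e e0.
have [|m [ms mt mr me]] := @good3 s t r (e / 36) Gs Gt Gr; first lra.
have := rhoE ms mt; have := rhoE mt mr; have := rhoE ms mr;
  rewrite /D !ler_norml.
move=> /andP[? ?] /andP[? ?] /andP[? ?].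
have := metric_triangle (f m s) (f m t) (f m r); lra.
Qed.

Let beta_ex s : exists b, G s -> forall n, good n s ->
  mdist (bf_proj (f n s)) b <= 6 * hp n.
Proof.
have [Gs|nG] := pselect (G s); last by exists (bf_proj (f 0%N s)).
have pstep n m : (n <= m)%N -> good n s ->
    mdist (bf_proj (f m s)) (bf_proj (f m.+1 s)) <= 3 * hp m.
  move=> nm /(_ m nm) /negP; rewrite negbK.
  by case: (dP m) => /(_ (f m s) (f m.+1 s)) + _ _ _ _; rewrite /f; lra.
have tel n m : good n s -> (n <= m)%N ->
    mdist (bf_proj (f n s)) (bf_proj (f m s)) <= 6 * (hp n - hp m).
  move=> gs /subnK <-; elim: (m - n)%N => [|p ih].
    by rewrite add0n mdistxx subrr mulr0.
  rewrite addSn half_powS.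
  have := pstep n (p + n)%N (leq_addl _ _) gs.
  have := metric_triangle (bf_proj (f n s)) (bf_proj (f (p + n)%N s))
    (bf_proj (f (p + n).+1 s)).
  by move: ih; lra.
have tel' n m : good n s -> (n <= m)%N ->
    mdist (bf_proj (f n s)) (bf_proj (f m s)) <= 6 * hp n.
  by move=> gs nm; move: (tel n m gs nm) (hp0 m); lra.
have [b bP] : exists b, converges_to (@mdist R B) (fun n => bf_proj (f n s)) b.
  apply: Bc => e e0; have [|n [_ gs ne]] := @good_large s (e / 12) 0%N Gs;
    first lra.
  exists n => p q np nq.
  have := metric_triangle (bf_proj (f p s)) (bf_proj (f n s)) (bf_proj (f q s)).
  rewrite (metric_sym (bf_proj (f p s)) (bf_proj (f n s))).
  by move: (tel' n p gs np) (tel' n q gs nq); lra.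
exists b => _ n gs; apply/ler_addgt0Pr => e /bP[m me].
have := metric_triangle (bf_proj (f n s)) (bf_proj (f (maxn n m) s)) b.
by move: (tel' _ _ gs (leq_maxl n m)) (me _ (leq_maxr n m)); lra.
Qed.

Let beta s := sval (cid (beta_ex s)).

Let betaE n s : good n s -> mdist (bf_proj (f n s)) (beta s) <= 6 * hp n.
Proof. by move=> gs; apply: (svalP (cid (beta_ex s))) => //; exists n. Qed.

Let beta_lip s t : G s -> G t -> mdist (beta s) (beta t) <= rho s t.
Proof.
move=> Gs Gt; apply/ler_addgt0Pr => e e0.
have [|m [ms mt _ me]] := @good3 s t t (e / 24) Gs Gt Gt; first lra.
have := rhoE ms mt; rewrite /D ler_norml => /andP[? ?].
have := metric_triangle (beta s) (bf_proj (f m s)) (beta t).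
have := metric_triangle (bf_proj (f m s)) (bf_proj (f m t)) (beta t).
have := metric_sym (beta s) (bf_proj (f m s)).
by move: (betaE ms) (betaE mt) (bf_proj_lip (f m s) (f m t)); lra.
Qed.

(** Two good samples with the same label at level [m] have the same point in [X m], hence are within
    12 2^-m for [rho]. One sample per level and label suffices, which is a countable choice. *)
Let dense_in (H : set T) : H `<=` G -> H !=set0 ->
  exists u : nat -> T, (forall p, H (u p)) /\
    forall s (e : R), H s -> 0 < e -> exists p, rho s (u p) < e.
Proof.
move=> HG [s0 Hs0].
have /choice[w wP] (p : nat * nat) : exists s, H s /\
    forall s', H s' -> good p.1 s' -> k p.1 s' = p.2 -> good p.1 s /\ k p.1 s =
      p.2.
  have [[s' [Hs' gs' ks']]|h] :=
      pselect (exists s', [/\ H s', good p.1 s' & k p.1 s' = p.2]).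
    by exists s'.
  by exists s0; split=> // s' Hs' gs' ks'; exfalso; apply: h; exists s'.
exists (fun p => if unpickle p is Some q then w q else s0); split.
  by move=> p; case: (unpickle p) => // q; have [] := wP q.
move=> s e Hs e0; have [|m [_ ms me]] := @good_large s (e / 12) 0%N (HG _ Hs);
  first lra.
exists (pickle (m, k m s)); rewrite pickleK.
have [_ /(_ s Hs ms erefl)[/= gw kw]] := wP (m, k m s).
have := rhoE ms gw; rewrite /D /f kw mdistxx sub0r normrN ler_norml =>
  /andP[_]; lra.
Qed.

Let ball_in t r := [set s | G s /\ rho s t < r].

Let mball t r : G t -> measurable (ball_in t r).
Proof.
move=> Gt.
(* At a fixed level the condition depends only on the label of [s]. The margin 12 2^-n makes it
   sufficient, and it holds at late levels when [rho s t < r]. *)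
rewrite (_ : ball_in t r = \bigcup_n
  ([set s | good n s /\ mdist (f n s) (f n t) + 12 * hp n < r] `&` [set _ |
    good n t])).
  apply: bigcupT_measurable => n; have [gt|ngt] := pselect (good n t).
    rewrite (_ : [set _ | good n t] = setT); last by apply/seteqP; split.
    rewrite setIT; apply: measurableI => //.
    exact: (measurable_simple [set i | mdist (x n i) (f n t) + 12 * hp n < r]
      (ks n)).
  rewrite (_ : [set _ | good n t] = set0) ?setI0//.
  by rewrite -subset0 => s.
apply/seteqP; split=> s /=.
  move=> [Gs st]; have [|m [ms mt _ me]] := @good3 s t t ((r - rho s t) / 24)
    Gs Gt Gt.
    by lra.
  exists m => //; split=> //; split=> //.
  have := rhoE ms mt; rewrite /D ler_norml => /andP[_]; lra.
move=> [n _ [[gs h] gt]]; split; first by exists n.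
have := rhoE gs gt; rewrite /D ler_norml => /andP[+ _]; lra.
Qed.

(** The null balls among those of radii [invS R m] about a dense sequence are removed. Any ball at a
    remaining sample contains such a ball of positive probability. This gives full support of the
    limit. *)
Let support_ex : exists G' : set T, [/\ measurable G', G' `<=` G, Pr P G' = 1
  & forall s (e : R), G' s -> 0 < e -> 0 < Pr P (G' `&` ball_in s e)].
Proof.
have G0 : G !=set0 by apply: (@Pr_gt0_nonempty _ _ _ P); rewrite PG.
have [u [uG ud]] := dense_in (@subset_refl _ G) G0.
pose V p m := [set s | ball_in (u p) (invS R m) s /\
   Pr P (ball_in (u p) (invS R m)) = 0].
have mV p m : measurable (V p m).
  have [h|h] := pselect (Pr P (ball_in (u p) (invS R m)) = 0).
    rewrite (_ : V p m = ball_in (u p) (invS R m)); first exact: mball.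
    by apply/seteqP; split=> s; [case|split].
  by rewrite (_ : V p m = set0)// -subset0 => s [_ /h].
have V0 p m : Pr P (V p m) = 0.
  have [h|h] := pselect (Pr P (ball_in (u p) (invS R m)) = 0).
    rewrite (_ : V p m = ball_in (u p) (invS R m))//.
    by apply/seteqP; split=> s; [case|split].
  by rewrite (_ : V p m = set0) ?Pr0// -subset0 => s [_ /h].
pose W := \bigcup_p \bigcup_m V p m.
have mW : measurable W by apply: bigcupT_measurable => p;
  exact: bigcupT_measurable.
have W0 : Pr P W = 0.
  apply: Pr_bigcup_null => [p|p]; first exact: bigcupT_measurable.
  exact: Pr_bigcup_null.
have mG' : measurable (G `\` W) by exact: measurableD.
have PG' : Pr P (G `\` W) = 1.
  have := PrDI P mG mW; rewrite PG.
  have := le_Pr P (measurableI _ _ mG mW) mW (@subIsetr _ G W).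
  by have := Pr_ge0 P (G `&` W); rewrite W0; lra.
exists (G `\` W); split=> //.
move=> s e [Gs nWs] e0.
have ms : measurable (ball_in s e) by exact: mball.
apply: (@lt_le_trans _ _ (Pr P (ball_in s e))); last first.
  by have := Pr_setI_ge P ms mG'; rewrite PG' subrr addr0 setIC.
have [|m /(_ m (leqnn m)) me] := @invS_lt R (e / 2); first lra.
have [p sp] := ud s _ Gs (invS_gt0 R m).
have pos : 0 < Pr P (ball_in (u p) (invS R m)).
  rewrite lt_neqAle Pr_ge0 andbT eq_sym; apply/eqP => h.
  by apply: nWs; exists p => //; exists m.
apply: lt_le_trans pos _; apply: le_Pr => //; first exact: mball.
move=> t [Gt tp]; split=> //; have := rho_tri Gt (uG p) Gs.
by rewrite (rhoC (uG p) Gs); lra.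
Qed.

Lemma limit_field : exists2 Y : mmField B, fully_supported Y &
  forall n, hp n *+ 6 < 1 -> gp_close Y (X n) (hp n *+ 8).
Proof.
have [G' [mG' G'G PG' G'pos]] := support_ex.
have G'0 : G' !=set0 by apply: (@Pr_gt0_nonempty _ _ _ P); rewrite PG'.
have [u [uG' ud]] := dense_in G'G G'0.
pose S := {s : T | G' s}.
pose us p : S := exist _ (u p) (uG' p).
have SG (s : S) : G (sval s) by apply: G'G; exact: svalP.
have [||||||Y [i [iI iD iB]]] := @completion_field R S (us 0%N) (fun s t => rho
  (sval s) (sval t))
    _ _ _ B (fun s => beta (sval s)) us.
- by move=> s; exact: rho0.
- by move=> s t; exact: rhoC.
- by move=> s t r; exact: rho_tri.
- exact: Bc.
- by move=> s t; exact: beta_lip.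
- by move=> s e e0; have [p sp] := ud _ _ (svalP s) e0; exists p.
(* The default value is taken only on a null set. *)
pose F s : Y := if pselect (G' s) is left h then i (exist _ s h) else point.
have FE s (h : G' s) : F s = i (exist _ s h).
  by rewrite /F; case: pselect => // h'; congr (i _); exact: eq_exist.
have Fdist s t : G' s -> G' t -> mdist (F s) (F t) = rho s t.
  by move=> hs ht; rewrite !FE iI.
have Fproj s : G' s -> bf_proj (F s) = beta s by move=> hs; rewrite FE iB.
have mF : measurable_fun setT (F : T -> borel Y).
  apply: (@measurability _ _ T (borel Y) setT F (@open Y)) => //.
  move=> _ [U oU <-]; rewrite setTI.
  pose V p m := [set s | (G' s /\ ball_in (u p) (invS R m) s) /\
    forall y, mdist (F (u p)) y < invS R m -> U y].
  have mV p m : measurable (V p m).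
    have [h|h] := pselect (forall y, mdist (F (u p)) y < invS R m -> U y).
      rewrite (_ : V p m = G' `&` ball_in (u p) (invS R m)).
        by apply: measurableI => //; apply: mball; exact: G'G.
      by apply/seteqP; split=> s; [case|split].
    by rewrite (_ : V p m = set0)// -subset0 => s [_ /h].
  (* An open set is reached through the countably many balls about the dense samples that map into
     it. *)
  rewrite (_ : F @^-1` U = (\bigcup_p \bigcup_m V p m) `|` (~` G' `&` [set _ |
    U point])).
    apply: measurableU.
      by apply: bigcupT_measurable => p; exact: bigcupT_measurable.
    apply: measurableI; first exact: measurableC.
    have [h|h] := pselect (U point).
      by rewrite (_ : [set _ | _] = setT)//; apply/seteqP; split.
    by rewrite (_ : [set _ | _] = set0)// -subset0 => s.
  apply/seteqP; split=> s /=.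
    move=> UFs; have [hs|nhs] := pselect (G' s); last first.
      by right; split=> //; move: UFs; rewrite /F; case: pselect.
    left; move/open_metricP: oU => /(_ _ UFs)[e e0 eU].
    have [|m /(_ m (leqnn m)) me] := @invS_lt R (e / 2); first lra.
    have [p sp] := ud s _ hs (invS_gt0 R m).
    exists p => //; exists m => //; split; first by split=> //; split=> //;
      exact: G'G.
    move=> y py; apply: eU; move: (metric_triangle (F s) (F (u p)) y).
    by rewrite Fdist//; lra.
  move=> [[p _ [m _ [[hs [_ sp]] h]]]|[nhs Up]].
    by apply: h; rewrite metric_sym Fdist.
  by rewrite /F; case: pselect.
have [Q QE] := law_probability P mF.
pose YQ : mmField B := @MMField R B Y Q.
have massE (A : set YQ) : mass A = Pr P (F @^-1` A) by rewrite /mass /Pr QE.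
have mFA (A : set (borel Y)) : measurable A -> measurable (F @^-1` A).
  by move=> mA; rewrite -[F @^-1` A]setTI; exact: mF.
exists YQ.
  apply/seteqP; split=> // y _ U oU Uy.
  rewrite PrE; last exact: measurable_open.
  rewrite lte_fin -/(mass U) massE;
    move/open_metricP: (oU) => /(_ y Uy)[e e0 eU].
  have [|s ys] := iD y (e / 2); first lra.
  have := G'pos (sval s) (e / 2) (svalP s); rewrite divr_gt0// => /(_ isT) pos.
  apply: lt_le_trans pos _; apply: le_Pr.
  - by apply: measurableI => //; apply: mball.
  - by apply: mFA; exact: measurable_open.
  - move=> t [ht [_ ts]]; apply: eU; rewrite FE.
    move: (metric_triangle y (i s) (i (exist _ t ht))).
    by rewrite (metric_sym (i s)) iI/=; lra.
move=> n n6.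
have mgG : measurable (good n `&` G') by exact: measurableI.
have gG : 1 - hp n *+ 6 <= Pr P (good n `&` G').
  have := Pr_setI_ge P (mgood n) mG'; rewrite PG' subrr addr0.
  exact: le_trans (Pgood n).
have [s0 s0P] : (good n `&` G') !=set0 by apply: (@Pr_gt0_nonempty _ _ _ P);
  lra.
(* Each good sample is paired with its point in [X n] and its limit in [Y]. The distortion 12 2^-n
   is twice the edge length 6 2^-n, which also bounds the distance of the projections. [n6] makes
   this index set nonempty. *)
pose I := {s | (good n `&` G') s}.
pose i0 : I := exist _ s0 s0P.
pose a (j : I) : X n := f n (sval j); pose b (j : I) : YQ := F (sval j).
have rhoI (j l : I) : `|mdist (a j) (a l) - mdist (b j) (b l)| <= 12 * hp n.
  by case: j l => s [gs hs] [t [gt ht]]; rewrite /a /b/= Fdist//; exact: rhoE.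
have abB j : mdist (bf_proj (a j)) (bf_proj (b j)) <= hp n *+ 6.
  case: j => s [gs hs]; rewrite /a /b/= Fproj//.
  by have := betaE gs; rewrite mulr_natl.
have cP : cross_metric (cross_of_pairs a b (hp n *+ 6)).
  apply: (cross_metric_of_pairs i0) => // j l; have := rhoI j l;
    rewrite ler_norml => /andP[? ?]; lra.
exists (fun y z => cross_of_pairs a b (hp n *+ 6) z y);
  first exact: cross_metric_sym.
move=> A mA; rewrite massE.
(* 7 makes the bound 6 2^-n strict, and [fits] adds one more 2^-n, hence 8. In mass, 6 2^-n is lost
   outside the good samples and 2^-n in [fits]. *)
pose A' : set (X n) := [set z | exists2 y, A y & cross_of_pairs a b (hp n *+ 6)
  z y < hp n *+ 7].
have h1 := Pr_setI_ge P (mFA A mA) mgG.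
have h2 : Pr P (F @^-1` A `&` (good n `&` G')) <= Pr P [set s | A' (f n s)].
  apply: le_Pr; first by apply: measurableI => //; exact: mFA.
    exact: (measurable_simple [set j | A' (x n j)] (ks n)).
  move=> s [As [gs hs]]; exists (F s) => //.
  have := @cross_of_pairs_le R B (X n) YQ I a b (hp n *+ 6) abB (f n s) (F s)
    (exist _ s (conj gs hs)).
  by rewrite /a /b/= !mdistxx; have := hp0 n; lra.
have h3 := kfit A'.
have h4 : mass (thickening A' (hp n)) <=
    mass (thick (fun y z => cross_of_pairs a b (hp n *+ 6) z y) A (hp n *+ 8)).
  apply: le_Pr.
  - by apply: measurable_open; exact: (@open_thickening R (X n)).
  - exact: (measurable_thick (cross_metric_sym cP)).
  - move=> z [z' [y Ay z'y] z'z]; exists y => //.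
    case: cP => _ /(_ z z' y) + _ _ _; rewrite (metric_sym z); lra.
move: h1 h2 h3 h4 gG (hp0 n); rewrite /f; lra.
Qed.

End limit.

Lemma gp_close_limit (R : realType) (B : metricType R) (X : nat -> mmField B) :
  complete_distance (@mdist R B) ->
  (forall n, gp_close (X n) (X n.+1) (half_pow R n)) ->
  exists2 Y : mmField B, fully_supported Y &
    forall n, half_pow R n *+ 6 < 1 -> gp_close Y (X n) (half_pow R n *+ 8).
Proof.
move=> Bc Xc.
have deltaP n : exists delta : X n -> X n.+1 -> R,
    cross_metric delta /\ transports delta (half_pow R n).
  by have [delta] := Xc n; exists delta.
pose delta n := sval (cid (deltaP n)).
have dP n : cross_metric (delta n) /\ transports (delta n) (half_pow R n).
  exact: (svalP (cid (deltaP n))).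
pose P := @uniform_prob R 0 1 ltr01 : probability _ R.
(* The states of the dependent choice carry the invariant that [coupling_step] requires and
   restores. *)
pose labels n := {p : (_ -> nat) * nat * (nat -> X n) |
  simple p.1.1 p.1.2 /\ fits P p.1.1 p.2 (half_pow R n)}.
pose link n (p : labels n) (p' : labels n.+1) :=
  Pr P [set s | ~~ (delta n ((sval p).2 ((sval p).1.1 s))
    ((sval p').2 ((sval p').1.1 s)) < half_pow R n *+ 3)] <= half_pow R n *+ 3.
(* At level 0 the allowed error is 1, so a constant variable fits. *)
have l0 : labels 0%N.
  exists ((fun=> 0%N), 0%N, (fun=> point)); split=> /=.
    by split=> // j; rewrite preimage_cst; case: ifP.
  move=> A; apply: (@le_trans _ _ 1).
    by apply: Pr_le1; rewrite [X in measurable X](preimage_cst point A);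
      case: ifP.
  by rewrite /half_pow expr0 lerDr Pr_ge0.
have [|l lP] := @dependent_choice_nat labels link l0.
  move=> n [[[k N] x] [/= ks kf]].
  have [dn tn] := dP n.
  have [k' [M [y [k's k'f k'd]]]] := coupling_step (@uniform_prob_splittable R)
    dn tn (half_pow_gt0 R n.+1) (le_half_pow R (leqnSn n)) ks kf.
  by exists (exist _ (k', M, y) (conj k's k'f)).
apply: (@limit_field R B Bc _ _ P X delta (fun n => (sval (l n)).1.1)
  (fun n => (sval (l n)).1.2) (fun n => (sval (l n)).2)).
- by move=> n; have [] := dP n.
- by move=> n; have [] := svalP (l n).
- by move=> n; have [] := svalP (l n).
- exact: lP.
Qed.

(** * The metric space of isomorphism classes *)

Section dGP_metric.
Context {R : realType} {B : metricType R}.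
Implicit Types X Y W : mmField B.

Lemma gp_close_dGP X Y (e : R) : 0 < e -> gp_close X Y (dGP X Y + e).
Proof. by move=> e0; apply: gp_close_of_dGP; rewrite ltrDl. Qed.

Lemma dGP_sym X Y : dGP X Y = dGP Y X.
Proof.
suff h X' Y' : dGP X' Y' <= dGP Y' X' by apply/eqP; rewrite eq_le !h.
apply/ler_addgt0Pr => e e0; apply: dGP_le; first by rewrite ltr_wpDl ?dGP_ge0.
by apply: gp_close_sym; exact: gp_close_dGP.
Qed.

Lemma dGP_triangle X Y W : dGP X W <= dGP X Y + dGP Y W.
Proof.
apply/ler_addgt0Pr => e e0.
have e20 : 0 < e / 2 by rewrite divr_gt0.
have -> : dGP X Y + dGP Y W + e = (dGP X Y + e / 2) + (dGP Y W + e / 2) by lra.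
apply: dGP_le; first by rewrite addr_gt0// ltr_wpDl ?dGP_ge0.
by apply: (gp_close_trans (Y := Y)); exact: gp_close_dGP.
Qed.

Lemma dGP_eq0 X Y : fully_supported X -> fully_supported Y ->
  dGP X Y = 0 <-> mm_isomorphic X Y.
Proof.
move=> Xs Ys; split=> [XY|iso].
  by apply: gp_close_isomorphic => // e e0; apply: gp_close_of_dGP; rewrite XY.
apply/eqP; rewrite eq_le dGP_ge0 andbT; apply/ler_addgt0Pr => e e0.
by rewrite add0r; apply: dGP_le => //; exact: isomorphic_gp_close.
Qed.

Lemma fs_isomorphic_eq0 (X Y : fsField B) :
  fs_isomorphic X Y <-> dGP (sval X) (sval Y) = 0.
Proof. by split=> h; apply/dGP_eq0 => //; exact: svalP. Qed.

Lemma fs_isomorphic_refl (X : fsField B) : fs_isomorphic X X.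
Proof.
by exists id; split=> //; exists id.
Qed.

(** Symmetry and transitivity of isomorphism are read off from [dGP], without inverting or composing
    maps. *)
Lemma fs_isomorphic_eq (X Y : fsField B) : fs_isomorphic X Y ->
  fs_isomorphic X = fs_isomorphic Y.
Proof.
move=> /fs_isomorphic_eq0 XY; apply/funext => W; apply/propext.
rewrite !fs_isomorphic_eq0.
have h1 := dGP_triangle (sval X) (sval Y) (sval W).
have h2 := dGP_triangle (sval Y) (sval X) (sval W).
rewrite (dGP_sym (sval Y) (sval X)) XY !add0r in h1 h2.
suff -> : dGP (sval X) (sval W) = dGP (sval Y) (sval W) by [].
by apply/eqP; rewrite eq_le h1 h2.
Qed.

Lemma isoReprE (C : isoClasses B) : sval C = fs_isomorphic (isoRepr C).
Proof. exact: (svalP (cid (svalP C))). Qed.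

Lemma dGP_isoRepr (X : fsField B) : dGP (sval X) (sval (isoRepr (isoClass X)))
  = 0.
Proof.
apply/fs_isomorphic_eq0.
have /= -> := isoReprE (isoClass X); exact: fs_isomorphic_refl.
Qed.

(** Each field is at distance 0 from the chosen representative of its class, so the triangle
    inequality gives independence of the choice. *)
Lemma dGP_classesE (X Y : fsField B) :
  dGP_classes (isoClass X) (isoClass Y) = dGP (sval X) (sval Y).
Proof.
rewrite /dGP_classes.
set X' := sval (isoRepr (isoClass X)); set Y' := sval (isoRepr (isoClass Y)).
have X0 : dGP (sval X) X' = 0 := dGP_isoRepr X.
have Y0 : dGP (sval Y) Y' = 0 := dGP_isoRepr Y.
have := dGP_triangle X' (sval X) Y'; have := dGP_triangle (sval X) (sval Y) Y'.
have := dGP_triangle (sval X) X' (sval Y); have := dGP_triangle X' Y' (sval Y).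
rewrite (dGP_sym X' (sval X)) (dGP_sym Y' (sval Y)) X0 Y0 => ? ? ? ?.
by apply/eqP; rewrite eq_le; apply/andP; split; lra.
Qed.

Lemma is_metric_dGP_classes : is_metric (@dGP_classes R B).
Proof.
split.
- by move=> C D; exact: dGP_ge0.
- move=> C D; split=> [/fs_isomorphic_eq0/fs_isomorphic_eq CD|<-].
    have : sval C = sval D by rewrite !isoReprE CD.
    by case: C D {CD} => C hC [D hD] /= CD; exact: eq_exist.
  by apply/fs_isomorphic_eq0; exact: fs_isomorphic_refl.
- by move=> C D; exact: dGP_sym.
- by move=> C D E; exact: dGP_triangle.
Qed.

Lemma complete_dGP_classes : complete_distance (@mdist R B) ->
  complete_distance (@dGP_classes R B).
Proof.
move=> Bc u uC; have [_ _ _ tri] := is_metric_dGP_classes.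
have /choice[N NP] n : exists N, forall p q, (N <= p)%N -> (N <= q)%N ->
    dGP_classes (u p) (u q) < half_pow R n.
  exact: uC (half_pow_gt0 R n).
(* Running maxima make [phi] monotone, so that consecutive terms of the subsequence are within
   2^-n. *)
pose phi n := (\max_(i < n.+1) N i)%N.
have Nphi n : (N n <= phi n)%N by exact: (leq_bigmax (ord_max : 'I_n.+1)).
have phiS n : (phi n <= phi n.+1)%N by rewrite /phi [X in (_ <=
  X)%N]big_ord_recr leq_maxl.
have [|Y Ys YX] := @gp_close_limit R B (fun n => sval (isoRepr (u (phi n)))) Bc.
  move=> n; apply: gp_close_of_dGP; apply: NP => //.
  exact: leq_trans (Nphi n) (phiS n).
pose Y' : fsField B := exist _ Y Ys.
exists (isoClass Y') => e e0.
(* 1/6 is the condition of [gp_close_limit]; 9 is 8 for the distance to the limit plus 1 for the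
   Cauchy bound. *)
have [|n /(_ n (leqnn n))] := @half_pow_lt R (Num.min (1 / 6) (e / 9)).
  by rewrite lt_min; lra.
rewrite lt_min => /andP[n1 n2]; exists (phi n) => p np.
apply: le_lt_trans (tri _ (u (phi n)) _) _.
have h1 := NP n _ _ (leq_trans (Nphi n) np) (Nphi n).
have h6 : half_pow R n *+ 6 < 1 by lra.
have h8 : 0 < half_pow R n *+ 8 by rewrite pmulrn_lgt0// half_pow_gt0.
have h2 := dGP_le h8 (YX n h6).
suff : dGP_classes (u (phi n)) (isoClass Y') <= half_pow R n *+ 8 by lra.
have := dGP_triangle (sval (isoRepr (u (phi n)))) Y (sval (isoRepr (isoClass
  Y'))).
have := dGP_isoRepr Y'; rewrite /= => ->.
by rewrite addr0 (dGP_sym _ Y) => h3; apply: le_trans h3 _.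
Qed.

Lemma separable_dGP_classes : is_polish_metric (@mdist R B) ->
  separable_distance (@dGP_classes R B).
Proof.
move=> Bpol; refine (@separable_of_codes R (isoClasses B) (@dGP_classes R B) _)
  => e e0.
have [|c cP] := @field_codes R B (e / 2) Bpol; first by rewrite divr_gt0.
exists (fun C => c (sval (isoRepr C))) => C D /cP h.
apply: (@le_lt_trans _ _ (e / 2)); last lra.
by apply: dGP_le => //; rewrite divr_gt0.
Qed.

End dGP_metric.

Theorem theorem4p9 (R : realType) (B : metricType R)
    (B_polish : is_polish_metric (@mdist R B)) :
  (forall X Y : fsField B,
     dGP_classes (isoClass X) (isoClass Y) = dGP (sval X) (sval Y)) /\
  is_polish_metric (@dGP_classes R B).
Proof.
split; first exact: dGP_classesE.
split; first exact: is_metric_dGP_classes.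
  by have [_ Bc _] := B_polish; exact: complete_dGP_classes.
exact: separable_dGP_classes.
Qed.
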